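(* Let $(X_n)_{n>0}$ be a sequence of Lévy processes with triplets $(b,\sigma_n^2,\nu)\in\mathcal T_{+,M,\alpha}$, for some $M>0$ and $\alpha\in(0,2)$, where $\sigma_n\to0$ as $n\to\infty$. Let $\Delta>0$ be fixed. There exist positive constants $C,\tilde C>0$ only depending on $M$ and $\alpha$ such that: 1. If $\sigma_n(\log n)^{1/\alpha-1/2}\to\infty$ as $n\to\infty$, selecting $m_n^\star=O\big(\sqrt{\log n/(\Delta\sigma_n^2)}\big)$ leads to the rate $$\mathbb E\big[\|\hat f_{\Delta,m_n^\star}-f_\Delta\|^2\big]\le C\,\frac{\sqrt{\log n}}{\sigma_n\,n\,\Delta^{1/2}}.$$ 2. If $\sigma_n(\log n)^{1/\alpha-1/2}=O(1)$ as $n\to\infty$, selecting $m_n^\star=O\big((\log n)^{1/\alpha}\Delta^{-1/\alpha}\big)$ leads to the rate $$\mathbb E\big[\|\hat f_{\Delta,m_n^\star}-f_\Delta\|^2\big]\le\tilde C\,\frac{(\log n)^{1/\alpha}}{n\,\Delta^{1/\alpha}}.$$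
   Context: A Lévy process $X$ (with $X_0=0$ a.s.) with Lévy triplet $(b,\sigma^2,\nu)$, where $b\in\mathbb R$, $\sigma\ge 0$ and $\nu$ is a Lévy measure (a Borel measure on $\mathbb R$ with $\nu(\{0\})=0$, $\nu(\mathbb R)=\infty$ and $\int_{\mathbb R}(x^2\wedge 1)\,\nu(dx)<\infty$), has characteristic function $$\mathbb E[e^{iuX_t}]=\exp\Big(itub-\tfrac{t\sigma^2u^2}{2}+t\int_{\mathbb R}(e^{iux}-1-iux\mathbf 1_{|x|<1})\,\nu(dx)\Big),\quad u\in\mathbb R,\ t\ge 0.$$ For $M>0$ and $\alpha\in(0,2)$, $\mathcal T_{+,M,\alpha}$ is the set of triplets $(b,\sigma^2,\nu)$ with $b\in\mathbb R$, $\sigma^2>0$, and $\nu$ admitting a Lebesgue density $p$ such that $\int_{[-\eta,\eta]}x^2p(x)\,dx\ge M\eta^{2-\alpha}$ for all $0<\eta\le1$. For each $n$, write $X$ for the $n$-th process $X_n$ of the sequence. One observes the $n$ i.i.d. increments $X_{j\Delta}-X_{(j-1)\Delta}$, $j=1,\dots,n$, of this process; $f_\Delta$ (which depends on $n$ through $\sigma_n$) is the Lebesgue density of $X_\Delta$, and for a cutoff $m>0$, $$\hat\phi_{X_\Delta}(u)=\frac1n\sum_{j=1}^ne^{iu(X_{j\Delta}-X_{(j-1)\Delta})},\qquad \hat f_{\Delta,m}(x)=\frac1{2\pi}\int_{-m}^m\hat\phi_{X_\Delta}(u)e^{-iux}\,du.$$ $\|\cdot\|$ is the $L^2(\mathbb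 R)$ norm. *)

(* Defs.v *)
(* Complex numbers are the type R[i] of the real-closed library. *)
From HB Require Import structures.
From mathcomp Require Export all_boot all_order all_algebra.
From mathcomp Require Export all_classical all_reals all_analysis.
From mathcomp Require Export complex.
Export Order.TTheory GRing.Theory Num.Theory.
Export numFieldNormedType.Exports.

Set Implicit Arguments.
Unset Strict Implicit.
Unset Printing Implicit Defensive.

Local Open Scope classical_set_scope.
Local Open Scope ring_scope.
Local Open Scope complex_scope.

Section ComplexAnalysis.
Context {R : realType}.

Definition cexp (z : R[i]) : R[i] :=
  (expR (complex.Re z))%:C * (cos (complex.Im z) +i* sin (complex.Im z)).

(* The library only integrates (extended) real functions. *)
Definition cintegral {d} {T : measurableType d} (mu : {measure set T -> \bar R})
    (D : set T) (g : T -> R[i]) : R[i] :=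
  Rintegral mu D (fun x => complex.Re (g x)) +i* Rintegral mu D (fun x => complex.Im (g x)).

Definition L2norm (g : R -> R[i]) : \bar R :=
  Lnorm (@lebesgue_measure R) 2%:E (fun x => (ComplexField.Normc.normc (g x))%:E).

Definition has_lebesgue_density (mu : set R -> \bar R) (p : R -> R) : Prop :=
  [/\ measurable_fun [set: R] p,
      forall x, 0 <= p x &
      forall B : set R, measurable B ->
        mu B = (\int[@lebesgue_measure R]_(x in B) (p x)%:E)%E].

End ComplexAnalysis.

Section LevyTriplets.
Context {R : realType}.

Record levy_triplet := LevyTriplet {
  drift : R;
  gauss_var : R;
  levy_meas : {measure set (measurableTypeR R) -> \bar R}
}.

(* Infinite activity is part of this definition. *)
Definition is_levy_measure
    (nu : {measure set (measurableTypeR R) -> \bar R}) : Prop :=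
  [/\ nu [set 0] = 0%E,
      nu [set: R] = +oo%E &
      (\int[nu]_x (Num.min (x ^+ 2) 1)%:E < +oo)%E].

Definition class_plus (M alpha : R) (t : levy_triplet) : Prop :=
  [/\ 0 < gauss_var t,
      is_levy_measure (levy_meas t) &
      exists2 p : R -> R, has_lebesgue_density (levy_meas t) p &
        forall eta : R, 0 < eta -> eta <= 1 ->
          ((M * eta `^ (2 - alpha))%:E <=
           \int[@lebesgue_measure R]_(x in `[(- eta)%R, eta])
             (x ^+ 2 * p x)%:E)%E].

Definition levy_exponent (t : levy_triplet) (u : R) : R[i] :=
  (u * drift t) *i - (gauss_var t * u ^+ 2 / 2)%:C +
  cintegral (levy_meas t) [set: R]
    (fun x => cexp ((u * x) *i) - 1 - (u * x * \1_[set y | `|y| < 1] x) *i).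

End LevyTriplets.
Arguments levy_triplet R : clear implicits.

Section LevyProcesses.
Context {R : realType} {d : measure_display} {T : measurableType d}.
Variable P : probability T R.

Definition char_fun (Y : T -> R) (u : R) : R[i] :=
  cintegral P [set: T] (fun w => cexp ((u * Y w) *i)).

Definition mutually_independent {I : finType} (Y : I -> T -> R) : Prop :=
  forall (J : {set I}) (B : I -> set R), (forall i, measurable (B i)) ->
    P (\bigcap_(i in [set` J]) (Y i @^-1` B i)) =
    (\prod_(i in J) P (Y i @^-1` B i))%E.

(* Time is the half-line [0, +oo[: values at negative times are irrelevant. *)
Definition is_levy_process (X : R -> {RV P >-> R}) : Prop :=
  [/\ {ae P, forall w, X 0 w = 0},
      forall (k : nat) (t : nat -> R), 0 <= t 0%N ->
        (forall i, t i <= t i.+1) ->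
        mutually_independent
          (fun (i : 'I_k) (w : T) => X (t i.+1) w - X (t i) w),
      forall (s h : R) (B : set R), 0 <= s -> 0 <= h -> measurable B ->
        P [set w | B (X (s + h) w - X s w)] = P [set w | B (X h w - X 0 w)],
      forall t e : R, 0 <= t -> 0 < e ->
        P [set w | e <= `|X s w - X t w|]
          @[s --> within [set s | 0 <= s] (nbhs t)] --> 0%E &
      {ae P, forall w, forall t : R, 0 <= t ->
        X s w @[s --> t^'+] --> X t w /\
        (0 < t -> cvg (X s w @[s --> t^'-]))}].

Definition is_levy_process_with_triplet (X : R -> {RV P >-> R})
    (tr : levy_triplet R) : Prop :=
  is_levy_process X /\
  forall u t : R, 0 <= t ->
    char_fun (X t) u = cexp (t%:C * levy_exponent tr u).

End LevyProcesses.

Section Estimator.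
Context {R : realType}.
Variable n : nat.

Definition emp_char_fun (z : 'I_n -> R) (u : R) : R[i] :=
  (n%:R^-1)%:C * \sum_(j < n) cexp ((u * z j) *i).

Definition density_estimator (m : R) (z : 'I_n -> R) (x : R) : R[i] :=
  ((2 * pi)^-1)%:C *
  cintegral (@lebesgue_measure R) `[- m, m]%classic
    (fun u => emp_char_fun z u * cexp ((- (u * x)) *i)).

Context {d : measure_display} {T : measurableType d}.
Variable P : probability T R.

(* Index j stands for the increment over [j Delta, (j + 1) Delta], j < n. *)
Definition increments (Delta : R) (X : R -> {RV P >-> R}) (w : T)
    (j : 'I_n) : R :=
  X (j.+1%:R * Delta) w - X (j%:R * Delta) w.

Definition MISE (Delta : R) (X : R -> {RV P >-> R}) (m : R) (f : R -> R) :
    \bar R :=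
  (\int[P]_w
     L2norm (fun x =>
       (density_estimator m (increments Delta X w) x - (f x)%:C)%R) ^+ 2)%E.

End Estimator.
Arguments MISE {R} n {d T P} Delta X m f.

(* Main.v *)
Require Import Defs.
From HB Require Import structures.
From mathcomp Require Import measurable_realfun.
From mathcomp Require Import ring lra.

(** Why the theorem holds. In Fourier space the estimator is the empirical
    characteristic function cut off at m. The squared L2 error is therefore, up
    to a constant, the integral over [-m, m] of the squared error of the empirical
    characteristic function plus the integral of |phi|^2 over |u| > m, where phi
    is the characteristic function of X_Delta. The increments being independent
    and identically distributed, the first integral has expectation at most of
    order m/n, so everything rests on choosing m such that the second one is of
    order m/n as well.

    By the Levy-Khintchine formula |phi(u)|^2 is the product of
    exp(-Delta sigma^2 u^2) and exp(-2 Delta int (1 - cos(ux)) nu(dx)). The first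
    factor alone, with Delta sigma^2 m^2 = ln n, gives the first rate. For the
    second one, the jumps of size at most 1/|u| satisfy
    1 - cos(ux) >= (cos 1 / 2) (ux)^2, and the lower bound on the truncated second
    moment of nu turns the second factor into exp(-kappa Delta |u|^alpha) for
    |u| >= 1, with kappa = M cos 1; the cutoff is given by
    kappa Delta m^alpha = ln n. In both cases |phi(u)|^2 <= exp(-K |u|^beta) with
    K m^beta = ln n, and (u/m)^beta >= 1 + beta ln(u/m) yields
    |phi(u)|^2 <= (m/u)^2 / n for |u| > m once beta ln n >= 2
    (stretched_exp_tail_le); the integral of this over |u| > m is of order m/n.
    The rate is m/n in both regimes (MISE_le), with constants depending on M and
    alpha only.

    The passage to Fourier space requires two facts about real cosine
    transforms. Plancherel's inequality (plancherel_le) and the inversion formula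
    for an integrable density whose characteristic function is integrable
    (fourier_inversion_ae) are both obtained by Abel summation: the weight
    exp(-e|x|) makes all integrals absolutely convergent, its transform is the
    Poisson kernel 2e / (e^2 + w^2), a positive kernel of mass 2 pi, and e tends
    to 0. The Gaussian component makes phi integrable. *)

Set Implicit Arguments.
Unset Strict Implicit.
Unset Printing Implicit Defensive.

Local Open Scope classical_set_scope.
Local Open Scope ring_scope.

(** * Real-valued integrals, iterated integrals, densities *)

Section RealValuedIntegrals.
Context {d : measure_display} {T : measurableType d} {R : realType}.
Variable m : {measure set T -> \bar R}.
Implicit Types f h : T -> R.

Lemma integrable_scale (k : R) f : m.-integrable setT (EFin \o f) ->
  m.-integrable setT (EFin \o (fun x => k * f x)).
Proof. by move=> fi; exact: (integrableZl measurableT k fi). Qed.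

Lemma integrableM_bounded f h (c : R) : m.-integrable setT (EFin \o f) ->
  measurable_fun setT h -> (forall x, `|h x| <= c) ->
  m.-integrable setT (EFin \o (fun x => f x * h x)).
Proof.
move=> fi mh hc; have mf := measurable_int _ fi.
apply: (@le_integrable _ _ _ m _ measurableT _ (fun x => c%:E * (EFin \o f) x)%E).
- by apply/measurable_EFinP/measurable_funM => //; exact/measurable_EFinP.
- move=> x _; rewrite /= lee_fin !normrM mulrC ler_wpM2r//.
  by rewrite (le_trans (hc x))// ler_norm.
- exact: integrableZl.
Qed.

Lemma le_normr_Rintegral_abs f : measurable_fun setT f ->
  (`|\int[m]_x f x|%:E <= \int[m]_x `|f x|%:E)%E.
Proof.
move=> mf; have := le_abse_integral m measurableT (f := EFin \o f).
move=> /(_ (proj2 (measurable_EFinP _ _) mf)); apply: le_trans.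
rewrite /Rintegral; case: (\int[m]_x (f x)%:E)%E => //= [|];
by rewrite normr0 leey.
Qed.

Lemma Rintegral_indic_mkcond (D : set T) f :
  \int[m]_(x in D) f x = \int[m]_x (\1_D x * f x).
Proof.
rewrite Rintegral_mkcond; apply: eq_Rintegral => x _.
by rewrite patchE indicE; case: (x \in D); rewrite ?mul1r ?mul0r.
Qed.

Lemma Rintegral_dominated_cvg (D : set T) (f_ : nat -> T -> R) f (g : T -> R) :
  measurable D -> (forall n, measurable_fun D (f_ n)) ->
  (forall x, D x -> f_ n x @[n --> \oo] --> f x) ->
  m.-integrable D (EFin \o g) -> (forall n x, D x -> `|f_ n x| <= g x) ->
  (\int[m]_(x in D) f_ n x) @[n --> \oo] --> \int[m]_(x in D) f x.
Proof.
move=> mD mf ff ig fg.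
have iD n : m.-integrable D (EFin \o f_ n).
  apply: (@le_integrable _ _ _ m _ mD _ (EFin \o g)) => //.
    exact/measurable_EFinP.
  by move=> x Dx /=; rewrite lee_fin (le_trans (fg n x Dx))// ler_norm.
have mf_ n : measurable_fun D (EFin \o f_ n) by exact/measurable_EFinP.
have cf x : D x -> (EFin \o f_ n) x @[n --> \oo] --> (EFin \o f) x.
  by move=> Dx; apply: cvg_EFin; [exact: nearW|exact: ff].
have fg' n x : D x -> (`|(EFin \o f_ n) x| <= (EFin \o g) x)%E.
  by move=> Dx; rewrite lee_fin; exact: fg.
have fi : m.-integrable D (EFin \o f).
  apply: (@le_integrable _ _ _ m _ mD _ (EFin \o g)) => //.
    exact: (emeasurable_fun_cvg _ _ mf_ cf).
  move=> x Dx /=; rewrite lee_fin.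
  have h : `|f_ n x| @[n --> \oo] --> `|f x| by apply: cvg_norm; exact: ff.
  rewrite (le_trans _ (ler_norm _))// -(cvg_lim _ h)//.
  apply: limr_le; first by apply/cvg_ex; eexists; exact: h.
  by apply: nearW => n; exact: fg.
have := @dominated_cvg _ _ _ m D mD (fun n => EFin \o f_ n) (EFin \o f)
  (EFin \o g) mf_ cf (fun _ _ => isT) ig fg'.
rewrite -(fineK (integrable_fin_num mD fi)) => /fine_cvg.
exact.
Qed.

End RealValuedIntegrals.

Section IteratedIntegrals.
Context {d1 d2 : measure_display} {T1 : measurableType d1}
  {T2 : measurableType d2} {R : realType}.
Variable m1 : {sigma_finite_measure set T1 -> \bar R}.
Variable m2 : {sigma_finite_measure set T2 -> \bar R}.
Implicit Types (k : T1 -> T2 -> R) (a : T1 -> R) (b : T2 -> R).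

Lemma measurable_fun_swap k :
  measurable_fun [set: T1 * T2] (fun z => k z.1 z.2) ->
  measurable_fun [set: T2 * T1] (fun z => k z.2 z.1).
Proof.
move=> mk; apply: (measurableT_comp (f := fun z : T1 * T2 => k z.1 z.2)
  (g := fun z : T2 * T1 => (z.2, z.1)) mk).
exact: measurable_swap.
Qed.

Lemma measurable_Rintegral_param k :
  measurable_fun [set: T1 * T2] (fun z => k z.1 z.2) ->
  measurable_fun [set: T1] (fun x => \int[m2]_y k x y).
Proof.
move=> mk; apply: (measurableT_comp (fine_measurable measurableT)) => //.
pose f z := (k z.1 z.2)%:E.
have mf : measurable_fun [set: T1 * T2] f by exact/measurable_EFinP.
have -> : (fun x => \int[m2]_y (k x y)%:E)%E =
    ((fun x => \int[m2]_y f^\+ (x, y)) \- (fun x => \int[m2]_y f^\- (x, y)))%E.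
  apply/funext => x; rewrite integralE /=.
  under eq_integral do rewrite funeposE.
  under [X in (_ - X)%E]eq_integral do rewrite funenegE.
  by congr (_ - _)%E; apply: eq_integral => y _; rewrite ?funeposE ?funenegE.
apply: emeasurable_funB.
- apply: (measurable_fun_fubini_tonelli_F f^\+%E) => //.
  exact: measurable_funepos.
- apply: (measurable_fun_fubini_tonelli_F f^\-%E) => //.
  exact: measurable_funeneg.
Qed.

Lemma ge0_measurable_integral_param k :
  measurable_fun [set: T1 * T2] (fun z => k z.1 z.2) ->
  (forall x y, 0 <= k x y) ->
  measurable_fun [set: T1] (fun x => \int[m2]_y (k x y)%:E)%E.
Proof.
move=> mk k0.
apply: (measurable_fun_fubini_tonelli_F (fun z => (k z.1 z.2)%:E)) => //=.
- exact/measurable_EFinP.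
- by move=> z; rewrite lee_fin.
Qed.

Lemma ge0_integral_exchange k :
  measurable_fun [set: T1 * T2] (fun z => k z.1 z.2) ->
  (forall x y, 0 <= k x y) ->
  (\int[m1]_x \int[m2]_y (k x y)%:E = \int[m2]_y \int[m1]_x (k x y)%:E)%E.
Proof.
move=> mk k0; apply: (fubini_tonelli (fun z => (k z.1 z.2)%:E)) => //=.
- exact/measurable_EFinP.
- by move=> z; rewrite lee_fin.
Qed.

Section dominated.
Variables (k : T1 -> T2 -> R) (a : T1 -> R) (b : T2 -> R).
Hypothesis mk : measurable_fun [set: T1 * T2] (fun z => k z.1 z.2).
Hypothesis ia : m1.-integrable setT (EFin \o a).
Hypothesis ib : m2.-integrable setT (EFin \o b).
Hypothesis kab : forall x y, `|k x y| <= a x * b y.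

Let slice2 x : m2.-integrable setT (EFin \o k x).
Proof.
apply: (@le_integrable _ _ _ m2 _ measurableT _ (fun y => (a x)%:E * (b y)%:E)%E).
- apply/measurable_EFinP.
  exact: (measurableT_comp mk (pair1_measurable x)).
- by move=> y _ /=; rewrite lee_fin (le_trans (kab x y))// ler_norm.
- exact: integrableZl.
Qed.

Let slice1 y : m1.-integrable setT (EFin \o k^~ y).
Proof.
apply: (@le_integrable _ _ _ m1 _ measurableT _ (fun x => (b y)%:E * (a x)%:E)%E).
- apply/measurable_EFinP.
  exact: (measurableT_comp mk (pair2_measurable y)).
- by move=> x _ /=; rewrite lee_fin (le_trans (kab x y))// mulrC ler_norm.
- exact: integrableZl.
Qed.

Let joint : (m1 \x m2)%E.-integrable setT (fun z => (k z.1 z.2)%:E).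
Proof.
apply/integrable12ltyP; first exact/measurable_EFinP.
apply: (@le_lt_trans _ _
    (\int[m1]_x (`|a x|%:E * \int[m2]_y `|b y|%:E))%E); last first.
  rewrite ge0_integralZr//; last 2 first.
  - by apply/measurable_EFinP/measurableT_comp => //;
      exact/measurable_EFinP/(measurable_int _ ia).
  - by apply: integral_ge0.
  have /integrableP[_ /= a_lt] := ia; have /integrableP[_ /= b_lt] := ib.
  apply: lte_mul_pinfty => //; first exact: integral_ge0.
  by rewrite ge0_fin_numE//; exact: integral_ge0.
have mb : measurable_fun [set: T2] b
  by exact/measurable_EFinP/(measurable_int _ ib).
have ma : measurable_fun [set: T1] a
  by exact/measurable_EFinP/(measurable_int _ ia).
apply: ge0_le_integral => //=.
- by move=> x _; exact: integral_ge0.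
- have mf : measurable_fun [set: T1 * T2] (fun z => `|(k z.1 z.2)%:E|%E).
    exact/measurableT_comp/measurable_EFinP.
  exact: (measurable_fun_fubini_tonelli_F (fun z => `|(k z.1 z.2)%:E|%E)).
- by apply/emeasurable_funM => //; apply/measurable_EFinP/measurableT_comp.
- move=> x _; rewrite -ge0_integralZl//; last first.
    exact/measurable_EFinP/measurableT_comp.
  have mkx : measurable_fun [set: T2] (k x).
    by have /measurable_EFinP := measurable_int _ (slice2 x).
  apply: ge0_le_integral => //=.
  + exact/measurable_EFinP/measurableT_comp.
  + by apply/measurable_EFinP/measurable_funM => //; exact/measurableT_comp.
  + move=> y _; rewrite lee_fin (le_trans (kab x y))//.
    by rewrite -normrM ler_norm.
Qed.

(** Domination by a product of integrable functions makes every slice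
    integrable, not just almost every one, so that Fubini's theorem holds for
    the real-valued integral without exceptional points. *)
Lemma Rintegral_exchange :
  \int[m1]_x \int[m2]_y k x y = \int[m2]_y \int[m1]_x k x y.
Proof.
have := Fubini joint; rewrite /= => h; rewrite /Rintegral; congr fine.
under eq_integral => x _.
  rewrite fineK; last exact: (integrable_fin_num _ (slice2 x)).
  over.
rewrite h; apply: eq_integral => y _.
by rewrite fineK//; exact: (integrable_fin_num _ (slice1 y)).
Qed.

End dominated.

End IteratedIntegrals.

Section Density.
Import HBNNSimple.
Context {R : realType}.
Variable (nu : {measure set (measurableTypeR R) -> \bar R}) (p : R -> R).
Hypothesis nup : has_lebesgue_density nu p.
Let mu := @lebesgue_measure R.

Let mp : measurable_fun setT p. Proof. by case: nup. Qed.
Let p0 x : 0 <= p x. Proof. by case: nup => _. Qed.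

Let density_nnsfun (f : {nnsfun (measurableTypeR R) >-> R}) :
  (\int[nu]_x (f x)%:E = \int[mu]_x (f x * p x)%:E)%E.
Proof.
under [LHS]eq_integral do rewrite fimfunE -fsumEFin//.
rewrite [LHS]ge0_integral_fsum//; last 2 first.
- by move=> r; exact/measurable_EFinP/measurableT_comp.
- by move=> n x _; rewrite EFinM nnfun_muleindic_ge0.
under [RHS]eq_integral => x _.
  rewrite EFinM fimfunE -fsumEFin// ge0_mule_fsuml; last first.
    by move=> r; rewrite EFinM nnfun_muleindic_ge0.
  over.
rewrite [RHS]ge0_integral_fsum//; last 2 first.
- move=> r; apply/measurable_EFinP; apply: measurable_funM => //.
  exact/measurableT_comp.
- move=> n x _; apply: mule_ge0; last by rewrite lee_fin.
  by rewrite EFinM nnfun_muleindic_ge0.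
apply: eq_fsbigr => r _.
rewrite integralZl_indic_nnsfun//= integral_indic//= setIT.
have mf : measurable (f @^-1` [set r]) by exact: measurable_sfunP.
have [_ _ ->//] := nup.
under [RHS]eq_integral do rewrite EFinM -muleA.
have [r0|r0] := leP 0 r.
  rewrite ge0_integralZl//; last 2 first.
  - by apply/measurable_EFinP/measurable_funM.
  - by move=> x _; rewrite mule_ge0 ?lee_fin.
  congr (_ * _)%E; rewrite [LHS]integral_mkcond; apply: eq_integral => x _.
  by rewrite patchE indicE; case: ifPn; rewrite ?mul1e ?mul0e.
have -> : f @^-1` [set r] = set0 by rewrite preimage_nnfun0.
rewrite integral_set0 mule0 integral0_eq// => x _.
by rewrite indic0 mul0e mule0.
Qed.

Lemma ge0_integral_density (g : R -> \bar R) :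
  measurable_fun setT g -> (forall x, 0 <= g x)%E ->
  (\int[nu]_x g x = \int[mu]_x (g x * (p x)%:E))%E.
Proof.
move=> mg g0; pose h := nnsfun_approx (@measurableT _ (measurableTypeR R)) mg.
transitivity (lim (\int[nu]_x (h n x)%:E @[n --> \oo])%E).
  rewrite -monotone_convergence//=.
  - apply: eq_integral => ? _; apply/esym/cvg_lim => //=.
    exact: cvg_nnsfun_approx.
  - by move=> n; exact/measurable_EFinP.
  - by move=> n ? _; rewrite lee_fin.
  - by move=> ? _ ? ? mn; rewrite lee_fin; exact/lefP/nd_nnsfun_approx.
transitivity (lim (\int[mu]_x (h n x * p x)%:E @[n --> \oo])%E).
  by apply: congr_lim; apply/funext => n; exact: density_nnsfun.
rewrite -monotone_convergence//=.
- apply: eq_integral => x _; apply/cvg_lim => //=.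
  under eq_fun do rewrite EFinM.
  by apply: cvgeZr => //; exact: cvg_nnsfun_approx.
- by move=> n; apply/measurable_EFinP/measurable_funM.
- by move=> n x _; rewrite lee_fin mulr_ge0.
- move=> x _ i j ij; rewrite lee_fin ler_wpM2r//.
  exact/lefP/nd_nnsfun_approx.
Qed.

Lemma Rintegral_density (g : R -> R) : measurable_fun [set: measurableTypeR R] g ->
  \int[nu]_x g x = \int[mu]_x (p x * g x).
Proof.
move=> mg; rewrite /Rintegral; congr fine.
have mg' : measurable_fun [set: measurableTypeR R] (EFin \o g).
  exact/measurable_EFinP.
rewrite integralE [RHS]integralE.
rewrite (ge0_integral_density (measurable_funepos mg')) ?funepos_ge0//.
rewrite (ge0_integral_density (measurable_funeneg mg')) ?funeneg_ge0//.
congr (_ - _)%E; apply: eq_integral => x _.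
- rewrite !funeposE /= -!EFin_max -EFinM; congr EFin.
  by rewrite mulrC maxr_pMr// mulr0.
- rewrite !funenegE /= -!EFin_max -EFinM; congr EFin.
  by rewrite mulrC maxr_pMr// mulr0 mulrN.
Qed.

End Density.

(** * The Abel weight and the Poisson kernel *)

Section Reflection.
Context {R : realType}.
Let mu := @lebesgue_measure R.

Lemma Rintegral_reflect (f : R -> R) :
  mu.-integrable setT (EFin \o f) -> \int[mu]_x f (- x) = \int[mu]_x f x.
Proof.
move=> fi; rewrite /Rintegral; congr fine.
have mN : measurable_fun [set: measurableTypeR R] (-%R : _ -> measurableTypeR R).
  exact: oppr_measurable.
have nu A : measurable A -> pushforward mu (-%R : _ -> measurableTypeR R) A = mu A.
  exact: lebesgue_measureN.
have mf := measurable_int _ fi.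
have nfi : mu.-integrable setT ((EFin \o f) \o (-%R : _ -> measurableTypeR R)).
  apply/integrableP; split; first exact: measurableT_comp mf mN.
  have /integrableP[_] := fi; apply: le_lt_trans.
  rewrite -[leRHS](eq_measure_integral _ (fun A mA _ => nu A mA)).
  rewrite ge0_integral_pushforward//.
  exact: (measurableT_comp (@abse_measurable R setT) mf).
have := integral_pushforward mN mf nfi measurableT.
rewrite preimage_setT => <-; apply: eq_measure_integral => A mA _.
exact: nu.
Qed.

Lemma Rintegral_odd (f : R -> R) :
  mu.-integrable setT (EFin \o f) -> (forall x, f (- x) = - f x) ->
  \int[mu]_x f x = 0.
Proof.
move=> fi fN; have := Rintegral_reflect fi.
under eq_Rintegral => x _ do rewrite fN -mulN1r.
rewrite RintegralZl// mulN1r => h; lra.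
Qed.

End Reflection.

Section PoissonKernel.
Context {R : realType}.
Let mu := @lebesgue_measure R.
Variable e : R.
Hypothesis e0 : 0 < e.

Definition poisson (w : R) : R := 2 * e / (e ^+ 2 + w ^+ 2).

Let den_gt0 w : 0 < e ^+ 2 + w ^+ 2.
Proof. by rewrite ltr_pwDl ?sqr_ge0// exprn_gt0. Qed.

Lemma poisson_ge0 w : 0 <= poisson w.
Proof. by rewrite divr_ge0 ?mulr_ge0// ltW. Qed.

Lemma poissonN w : poisson (- w) = poisson w.
Proof. by rewrite /poisson sqrrN. Qed.

Lemma poisson_le w : poisson w <= 2 / e.
Proof.
rewrite ler_pdivrMr//.
have -> : 2 / e * (e ^+ 2 + w ^+ 2) = 2 * e + 2 / e * w ^+ 2.
  by field; rewrite gt_eqF.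
by rewrite lerDl mulr_ge0 ?sqr_ge0// divr_ge0// ltW.
Qed.

Lemma continuous_poisson : continuous poisson.
Proof.
move=> w; apply: cvgM; first exact: cvg_cst.
apply: cvgV; first by rewrite gt_eqF.
by apply: cvgD; [exact: cvg_cst|apply: (@cvgM _ _ _ _ id id)].
Qed.

Let F w (x : R) : R :=
  expR (- e * x) * (w * sin (w * x) / (e ^+ 2 + w ^+ 2)
                    - (e * cos (w * x) / (e ^+ 2 + w ^+ 2) + e^-1)).

Let is_derive_F (w x : R) : is_derive x (1 : R) (F w) (expR (- e * x) * (1 + cos (w * x))).
Proof.
have dZ a : is_derive x 1 (fun y : R => a * y) a.
  by apply: is_derive_eq (is_deriveZ a (is_derive_id x 1)) _; rewrite scaler1.
have dexp := is_derive1_comp (is_derive_expR (- e * x)) (dZ (- e)).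
have dsin := is_derive1_comp (is_derive_sin (w * x)) (dZ w).
have dcos := is_derive1_comp (is_derive_cos (w * x)) (dZ w).
pose D := e ^+ 2 + w ^+ 2.
have -> : F w = (expR \o ( *%R (- e))) *
    ((w / D) \*: (sin \o ( *%R w)) - ((e / D) \*: (cos \o ( *%R w)) + cst e^-1)).
  apply/funext => y; rewrite /F /= !fctE /= -/D.
  by congr (_ * (_ - (_ + _))); rewrite [RHS]mulrAC.
have dF := is_deriveM dexp (is_deriveB (is_deriveZ (w / D) dsin)
  (is_deriveD (is_deriveZ (e / D) dcos) (is_derive_cst e^-1 x 1))).
apply: (is_derive_eq dF); rewrite !fctE /=.
have D0 : D != 0 by rewrite gt_eqF// den_gt0.
have e_neq0 : e != 0 by rewrite gt_eqF.
rewrite /GRing.scale /= addr0.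
rewrite /D in D0 *; field.
by apply/andP.
Qed.

(** The Abel summability weight; its Fourier transform is the Poisson kernel. *)
Definition abel (x : R) : R := expR (- e * `|x|).

Lemma abel_ge0 x : 0 <= abel x. Proof. exact: expR_ge0. Qed.

Lemma abelN x : abel (- x) = abel x. Proof. by rewrite /abel normrN. Qed.

Lemma continuous_abel : continuous abel.
Proof.
move=> x; apply: (continuous_comp (f := fun x => - e * `|x|)).
  by apply: cvgM; [exact: cvg_cst|exact: norm_continuous].
exact: continuous_expR.
Qed.

Let cvg_F w : F w x @[x --> +oo%R] --> 0.
Proof.
pose D := e ^+ 2 + w ^+ 2; pose C := (`|w| + e) / D + e^-1.
have D0 : 0 < D by exact: den_gt0.
have Dn : `|D^-1| = D^-1 by rewrite gtr0_norm ?invr_gt0.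
have exp0 : expR (- e * x) @[x --> +oo%R] --> (0 : R).
  have -> : (fun x => expR (- e * x)) = (fun z => expR (- z)) \o ( *%R e).
    by apply/funext => x /=; rewrite mulNr.
  apply: (@cvg_comp _ _ _ _ _ _ (pinfty_nbhs R)); last exact: cvgr_expR.
  exact: gt0_cvgMry.
have CE0 : C * expR (- e * x) @[x --> +oo%R] --> (0 : R).
  by rewrite -(mulr0 C); apply: cvgM => //; exact: cvg_cst.
have NCE0 : - (C * expR (- e * x)) @[x --> +oo%R] --> (0 : R).
  by rewrite -oppr0; exact: cvgN.
apply: (squeeze_cvgr _ NCE0 CE0).
apply: nearW => x; rewrite -ler_norml /F normrM ger0_norm ?expR_ge0//.
rewrite mulrC ler_wpM2r ?expR_ge0// -/D.
rewrite (le_trans (ler_normB _ _))// /C mulrDl -addrA lerD//.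
  rewrite !normrM Dn ler_wpM2r ?invr_ge0 ?(ltW D0)//.
  by rewrite ler_piMr// sin_max.
rewrite (le_trans (ler_normD _ _))// lerD//; last by rewrite gtr0_norm// invr_gt0.
rewrite !normrM Dn ler_wpM2r ?invr_ge0 ?(ltW D0)//.
by rewrite gtr0_norm// ler_piMr ?cos_max// ltW.
Qed.

Let continuous_integrand w : continuous (fun x => abel x * (1 + cos (w * x))).
Proof.
move=> x; apply: cvgM; first exact: continuous_abel.
apply: cvgD; first exact: cvg_cst.
apply: (continuous_comp (f := *%R w)); last exact: continuous_cos.
by apply: cvgM; [exact: cvg_cst|exact: cvg_id].
Qed.

(** The summand 1 makes the integrand nonnegative, as improper integration
    against an antiderivative requires; taking w = 0 then removes it. *)
Let integral_abel1cos w :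
  (\int[mu]_x (abel x * (1 + cos (w * x)))%:E = (2 / e + poisson w)%:E)%E.
Proof.
rewrite ge0_symfun_integralT//; last 2 first.
- by move=> x; rewrite mulr_ge0 ?abel_ge0//; have := cos_geN1 (w * x); lra.
- by move=> x /=; rewrite abelN mulrN cosN.
- rewrite -set_itvcy.
  rewrite (@ge0_continuous_FTC2y _ _ (F w) 0 0).
  + rewrite /F !mulr0 expR0 sin0 cos0 !mulr0 mul0r mulr1 mul1r -EFinB -EFinM.
    congr EFin; rewrite /poisson; field.
    by rewrite !gt_eqF.
  + by move=> x _; rewrite mulr_ge0 ?abel_ge0//; have := cos_geN1 (w * x); lra.
  + by apply: continuous_subspaceT; exact: continuous_integrand.
  + exact: cvg_F.
  + by move=> x _; case: (is_derive_F w x).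
  + apply: cvg_at_right_filter.
    apply/differentiable_continuous/derivable1_diffP.
    by case: (is_derive_F w 0).
  + move=> x; rewrite in_itv/= andbT => x0; rewrite derive1E.
    by case: (is_derive_F w x) => _ ->; rewrite /abel gtr0_norm.
Qed.

Lemma integral_abel : (\int[mu]_x (abel x)%:E = (2 / e)%:E)%E.
Proof.
have := integral_abel1cos 0 => h.
transitivity (\int[mu]_x (2^-1%:E * (abel x * (1 + cos (0 * x)))%:E))%E.
  by apply: eq_integral => x _; rewrite mul0r cos0 -EFinM; congr EFin; field.
rewrite ge0_integralZl//; last 2 first.
- apply/measurable_EFinP.
  exact: (continuous_measurable_fun (@continuous_integrand 0)).
- by move=> x _; rewrite mul0r cos0 lee_fin mulr_ge0 ?abel_ge0.
rewrite h -EFinM /poisson expr0n addr0; congr EFin; field.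
by rewrite gt_eqF.
Qed.

Lemma integrable_abel : mu.-integrable setT (EFin \o abel).
Proof.
apply/integrableP; split.
  apply/measurable_EFinP; exact: (continuous_measurable_fun continuous_abel).
under eq_integral => x _ do rewrite /= ger0_norm ?abel_ge0//.
by rewrite integral_abel ltry.
Qed.

Lemma integrable_abelM (h : R -> R) : measurable_fun setT h ->
  (forall x, `|h x| <= 1) -> mu.-integrable setT (EFin \o (fun x => abel x * h x)).
Proof.
move=> mh h1; exact: integrableM_bounded integrable_abel mh h1.
Qed.

Let continuous_cosM (w : R) : continuous (fun x => cos (w * x)).
Proof.
move=> x; apply: (continuous_comp (f := *%R w)); last exact: continuous_cos.
by apply: cvgM; [exact: cvg_cst|exact: cvg_id].
Qed.

Let continuous_sinM (w : R) : continuous (fun x => sin (w * x)).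
Proof.
move=> x; apply: (continuous_comp (f := *%R w)); last exact: continuous_sin.
by apply: cvgM; [exact: cvg_cst|exact: cvg_id].
Qed.

Let Rintegral_abel_cos w : \int[mu]_x (abel x * cos (w * x)) = poisson w.
Proof.
have icos : mu.-integrable setT (EFin \o (fun x => abel x * cos (w * x))).
  apply: integrable_abelM => [|x]; last exact: cos_max.
  exact: (continuous_measurable_fun (@continuous_cosM w)).
have : \int[mu]_x (abel x + abel x * cos (w * x)) = 2 / e + poisson w.
  rewrite /Rintegral; under eq_integral => x _ do rewrite -{1}[abel x]mulr1 -mulrDr.
  by rewrite integral_abel1cos.
rewrite RintegralD//; last exact: integrable_abel.
by rewrite {1}/Rintegral integral_abel /= => /addrI.
Qed.

Let Rintegral_abel_sin w : \int[mu]_x (abel x * sin (w * x)) = 0.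
Proof.
apply: Rintegral_odd => [|x]; last by rewrite abelN mulrN sinN mulrN.
apply: integrable_abelM => [|x]; last exact: sin_max.
exact: (continuous_measurable_fun (@continuous_sinM w)).
Qed.

Lemma Rintegral_abel_cos_phase (w s : R) :
  \int[mu]_x (abel x * cos (w * x - s)) = cos s * poisson w.
Proof.
under eq_Rintegral => x _.
  rewrite cosB mulrDr !mulrA [_ * cos s]mulrC [_ * sin s]mulrC.
  over.
have icos : mu.-integrable setT (EFin \o (fun x => abel x * cos (w * x))).
  apply: integrable_abelM => [|x]; last exact: cos_max.
  exact: (continuous_measurable_fun (@continuous_cosM w)).
have isin : mu.-integrable setT (EFin \o (fun x => abel x * sin (w * x))).
  apply: integrable_abelM => [|x]; last exact: sin_max.
  exact: (continuous_measurable_fun (@continuous_sinM w)).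
rewrite RintegralD//; [|exact: integrable_scale..].
rewrite !RintegralZl//.
by rewrite Rintegral_abel_cos Rintegral_abel_sin mulr0 addr0.
Qed.

Let is_derive_affine (a b x : R) : is_derive x (1 : R) (fun y : R => a * y + b) a.
Proof.
have dF := is_deriveD (is_deriveZ a (is_derive_id x 1)) (is_derive_cst b x 1).
by apply: (is_derive_eq dF); rewrite scaler1 addr0.
Qed.

Let integral_oneDsqr : (\int[mu]_x (2 * (oneDsqr x)^-1)%:E = (2 * pi)%:E :> \bar R)%E.
Proof.
under eq_integral => x _ do rewrite EFinM.
have o0 x : 0 <= (oneDsqr x)^-1 :> R by rewrite invr_ge0 addr_ge0 ?sqr_ge0.
rewrite ge0_integralZl//; last first.
  apply/measurable_EFinP.
  exact: (continuous_measurable_fun (@continuous_oneDsqrV R)).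
rewrite ge0_symfun_integralT//; last 2 first.
- exact: continuous_oneDsqrV.
- by move=> x /=; rewrite /oneDsqr sqrrN.
by rewrite -set_itvcy integral0y_oneDsqr -!EFinM; congr EFin; field.
Qed.

(** The substitution v = e x + c reduces this to the integral of 1 / (1 + x^2),
    so the mass depends neither on the width e nor on the centre c. *)
Lemma integral_poisson (c : R) : (\int[mu]_v (poisson (v - c))%:E = (2 * pi)%:E)%E.
Proof.
have e_neq0 : e != 0 by rewrite gt_eqF.
pose aff (x : R) := e * x + c.
have daff : (aff^`())%classic = cst e.
  by apply/funext => x; rewrite derive1E; case: (is_derive_affine e c x).
rewrite (@increasing_ge0_integration_by_substitutionT _ aff); first last.
- by move=> v; exact: poisson_ge0.
- move=> v; apply: (continuous_comp (f := fun v => v - c)).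
    by apply: cvgB; [exact: cvg_id|exact: cvg_cst].
  exact: continuous_poisson.
- apply/cvgryPge => A; near=> x; rewrite /aff -lerBlDr mulrC -ler_pdivrMr//.
- apply/cvgrNyPle => A; near=> x; rewrite /aff -lerBrDr mulrC -ler_pdivlMr//.
- by move=> x; case: (is_derive_affine e c x).
- by rewrite daff; exact: is_cvg_cst.
- by rewrite daff; exact: is_cvg_cst.
- by rewrite daff; exact: cst_continuous.
- by move=> x y xy; rewrite ltrD2r ltr_pM2l.
rewrite -integral_oneDsqr daff; apply: eq_integral => x _.
congr EFin; rewrite !fctE /= /aff /poisson /oneDsqr addrK.
have d0 : 1 + x ^+ 2 != 0 by rewrite gt_eqF// ltr_pwDl// sqr_ge0.
by field; rewrite d0 gt_eqF.
Unshelve. all: by end_near. Qed.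

Lemma Rintegral_poisson_itv (y c d : R) : c < d ->
  \int[mu]_(x in `[c, d]) poisson (y - x) =
  2 * (atan ((d - y) / e) - atan ((c - y) / e)).
Proof.
move=> cd; have e_neq0 : e != 0 by rewrite gt_eqF.
pose G x := 2 * atan (e^-1 * x + (- y / e)).
have dG (x : R) : is_derive x (1 : R) G (poisson (y - x)).
  have dG' := is_deriveZ 2 (is_derive1_comp (g := fun z => e^-1 * z + - y / e)
    (is_derive1_atan (e^-1 * x + (- y / e))) (is_derive_affine e^-1 (- y / e) x)).
  apply: (is_derive_eq dG'); rewrite /GRing.scale /= /poisson.
  by field; rewrite e_neq0 gt_eqF.
have cG x : {for x, continuous G}.
  by apply/differentiable_continuous/derivable1_diffP; case: (dG x).
rewrite /Rintegral (@continuous_FTC2 _ _ G)//.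
- rewrite -EFinB /= /G -mulrBr; congr (2 * (atan _ - atan _)); field;
  by rewrite e_neq0.
- apply: continuous_subspaceT => x.
  apply: (continuous_comp (f := fun x => y - x)); last exact: continuous_poisson.
  by apply: cvgB; [exact: cvg_cst|exact: cvg_id].
- split.
  + by move=> x _; case: (dG x).
  + by apply: cvg_at_right_filter; exact: cG.
  + by apply: cvg_at_left_filter; exact: cG.
- by move=> x _; rewrite derive1E; case: (dG x).
Qed.
End PoissonKernel.

(** * Plancherel's inequality *)

Section Plancherel.
Context {R : realType}.
Let mu := @lebesgue_measure R.

Lemma measurable_cos_phase (s : R) :
  measurable_fun [set: measurableTypeR R * measurableTypeR R]
    (fun z => cos (z.1 * z.2 - s) : R).
Proof.
apply: (measurableT_comp (continuous_measurable_fun (@continuous_cos R))) => /=.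
by apply: measurable_funB => //; exact: measurable_funM.
Qed.

Lemma measurable_cos_phase1 (u s : R) :
  measurable_fun [set: measurableTypeR R] (fun x => cos (u * x - s) : R).
Proof.
apply: (measurableT_comp (continuous_measurable_fun (@continuous_cos R))) => /=.
by apply: measurable_funB => //; exact: measurable_funM.
Qed.

Lemma integrable_Mcos (g : R -> R) (u s : R) : mu.-integrable setT (EFin \o g) ->
  mu.-integrable setT (EFin \o (fun y => g y * cos (y * u - s))).
Proof.
move=> gi; apply: integrableM_bounded (1) gi _ _ => [|y]; last exact: cos_max.
under eq_fun do rewrite mulrC.
exact: measurable_cos_phase1.
Qed.

(** The phases 0 and pi/2 give the cosine and the sine transform; real transforms
    with a phase avoid integrals of complex functions. *)
Definition cos_transform (s : R) (a : R -> R) (x : R) : R :=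
  \int[mu]_u (a u * cos (u * x - s)).

Section kernel_bound.
Variables (s : R) (a : R -> R).
Hypothesis ia : mu.-integrable setT (EFin \o a).
Let r := cos_transform s a.
Let N := \int[mu]_u `|a u|.

Let ma : measurable_fun [set: measurableTypeR R] a.
Proof. by have /measurable_EFinP := measurable_int _ ia. Qed.

Let iacos x : mu.-integrable setT (EFin \o (fun u => a u * cos (u * x - s))).
Proof. exact: integrable_Mcos. Qed.

Let r_le x : `|r x| <= N.
Proof.
apply: (le_trans (le_normr_Rintegral measurableT (iacos x))).
apply: le_Rintegral => //; [exact: integrable_norm (iacos x)|exact: integrable_norm|].
by move=> u _; rewrite normrM ler_piMr// cos_max.
Qed.

Lemma measurable_cos_transform : measurable_fun [set: measurableTypeR R] r.
Proof.
apply: (@measurable_Rintegral_param _ _ _ _ _ mu (fun x u => a u * cos (u * x - s))).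
apply: measurable_funM; first exact: measurableT_comp.
under eq_fun do rewrite mulrC.
exact: measurable_cos_phase.
Qed.

Variable e : R.
Hypothesis e0 : 0 < e.

Let G u v := \int[mu]_x (abel e x * cos (v * x - s) * cos (u * x - s)).

(** The product of two cosines is a half sum of cosines of u - v and u + v, whose
    Abel integrals are Poisson kernels; the phase survives only as cos (2 s). *)
Let G_le u v : `|G u v| <= (poisson e (u - v) + poisson e (u + v)) / 2.
Proof.
have -> : G u v = (poisson e (u - v) + cos (2 * s) * poisson e (u + v)) / 2.
  have i1 w t : mu.-integrable setT (EFin \o (fun x => abel e x * cos (w * x - t))).
    apply: integrable_abelM => // [|x]; last exact: cos_max.
    exact: measurable_cos_phase1.
  rewrite -(Rintegral_abel_cos_phase e0 (u + v) (2 * s)).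
  have := Rintegral_abel_cos_phase e0 (u - v) 0; rewrite cos0 mul1r => <-.
  rewrite -RintegralD// [RHS]mulrC -RintegralZl//.
    apply: eq_Rintegral => x _.
    rewrite (_ : (u - v) * x - 0 = (u * x - s) - (v * x - s)); last by ring.
    rewrite (_ : (u + v) * x - 2 * s = (u * x - s) + (v * x - s)); last by ring.
    by move: (u * x - s) (v * x - s) => A B; rewrite cosB cosD; field.
  exact: integrableD (i1 _ _) (i1 _ _).
rewrite normrM (@ger0_norm _ 2^-1) ?invr_ge0// ler_wpM2r ?invr_ge0//.
rewrite (le_trans (ler_normD _ _))// lerD//.
  by rewrite ger0_norm// poisson_ge0.
by rewrite normrM (ger0_norm (poisson_ge0 _ _))// ler_piMl ?cos_max// poisson_ge0.
Qed.

(** One factor r(x) is expanded at a time, so that each exchange involves two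
    variables only. *)
Let abel_r2 : \int[mu]_x (abel e x * r x ^+ 2) =
  \int[mu]_v (a v * \int[mu]_u (a u * G u v)).
Proof.
have irabel : mu.-integrable setT (EFin \o (fun x => abel e x * r x)).
  exact: integrableM_bounded (integrable_abel e0) measurable_cos_transform r_le.
transitivity (\int[mu]_x \int[mu]_v (abel e x * r x * (a v * cos (v * x - s)))).
  by apply: eq_Rintegral => x _; rewrite RintegralZl// expr2 mulrA.
have nia : mu.-integrable setT (EFin \o (fun v => `|a v|)) by exact: integrable_norm.
rewrite (@Rintegral_exchange _ _ _ _ _ mu mu _ (fun x => `|abel e x * r x|)
  (fun v => `|a v|))//; last 3 first.
- apply: measurable_funM.
    apply: (measurableT_comp (f := fun x => abel e x * r x)) => //.
    by have /measurable_EFinP := measurable_int _ irabel.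
  apply: measurable_funM; first exact: measurableT_comp.
  under eq_fun do rewrite mulrC.
  exact: measurable_cos_phase.
- exact: integrable_norm.
- by move=> x v; rewrite normrM ler_wpM2l// normrM ler_piMr// cos_max.
apply: eq_Rintegral => v _.
have iabel : mu.-integrable setT (EFin \o (fun x => abel e x * cos (v * x - s))).
  apply: integrable_abelM => // [|x]; last exact: cos_max.
  exact: measurable_cos_phase1.
transitivity (\int[mu]_x (a v * (abel e x * cos (v * x - s) * r x))).
  by apply: eq_Rintegral => x _; ring.
have iabelr := integrableM_bounded iabel measurable_cos_transform r_le.
rewrite (RintegralZl (a v) measurableT iabelr); apply: congr1.
transitivity (\int[mu]_x \int[mu]_u
    (abel e x * cos (v * x - s) * (a u * cos (u * x - s)))).
  by apply: eq_Rintegral => x _; rewrite RintegralZl.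
rewrite (@Rintegral_exchange _ _ _ _ _ mu mu _
  (fun x => `|abel e x * cos (v * x - s)|) (fun u => `|a u|))//; last 3 first.
- apply: measurable_funM.
    apply: (measurableT_comp (f := fun x => abel e x * cos (v * x - s))) => //.
    by have /measurable_EFinP := measurable_int _ iabel.
  apply: measurable_funM; first exact: measurableT_comp.
  under eq_fun do rewrite mulrC.
  exact: measurable_cos_phase.
- exact: integrable_norm.
- by move=> x u; rewrite normrM ler_wpM2l// normrM ler_piMr// cos_max.
apply: eq_Rintegral => u _; rewrite -RintegralZl//.
  by apply: eq_Rintegral => x _; ring.
apply: integrableM_bounded (1) iabel _ _ => [|x]; last exact: cos_max.
exact: measurable_cos_phase1.
Qed.

Let H u v := (poisson e (u - v) + poisson e (u + v)) / 2.

Let H_ge0 u v : 0 <= H u v.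
Proof. by rewrite divr_ge0// addr_ge0// poisson_ge0. Qed.

Let mH : measurable_fun [set: measurableTypeR R * measurableTypeR R]
  (fun z => H z.1 z.2).
Proof.
have mP := continuous_measurable_fun (continuous_poisson e0).
apply: measurable_funM => //; apply: measurable_funD.
  by apply: (measurableT_comp mP); exact: measurable_funB.
by apply: (measurableT_comp mP); exact: measurable_funD.
Qed.

Let integral_H v : (\int[mu]_u (H u v)%:E = (2 * pi)%:E)%E.
Proof.
have mP t : measurable_fun [set: measurableTypeR R] (fun u => poisson e (u + t)).
  apply: (measurableT_comp (continuous_measurable_fun (continuous_poisson e0))).
  exact: measurable_funD.
transitivity (2^-1%:E * \int[mu]_u
    ((poisson e (u - v))%:E + (poisson e (u - (- v)))%:E))%E.
  rewrite -ge0_integralZl//.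
  - by apply: eq_integral => u _; rewrite opprK -EFinD -EFinM mulrC.
  - by apply/measurable_EFinP/measurable_funD; exact: mP.
  - by move=> u _; rewrite adde_ge0// lee_fin poisson_ge0.
rewrite ge0_integralD//.
- by rewrite !integral_poisson// -EFinD -EFinM; congr EFin; field.
- by move=> u _; rewrite lee_fin poisson_ge0.
- by apply/measurable_EFinP; exact: mP.
- by move=> u _; rewrite lee_fin poisson_ge0.
- by apply/measurable_EFinP; exact: mP.
Qed.

Let mG : measurable_fun [set: measurableTypeR R * measurableTypeR R]
  (fun z => G z.1 z.2).
Proof.
apply: (@measurable_Rintegral_param _ _
  (measurableTypeR R * measurableTypeR R)%type _ _ mu
  (fun z x => abel e x * cos (z.2 * x - s) * cos (z.1 * x - s))).
have mc := continuous_measurable_fun (@continuous_cos R).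
have mab := continuous_measurable_fun (@continuous_abel R e).
apply: measurable_funM; first apply: measurable_funM.
- exact: (measurableT_comp mab).
- apply: (measurableT_comp mc); apply: measurable_funB => //.
  apply: measurable_funM => //; exact: (measurableT_comp measurable_snd).
- apply: (measurableT_comp mc); apply: measurable_funB => //.
  apply: measurable_funM => //; exact: (measurableT_comp measurable_fst).
Qed.

(** Schur's test: the arithmetic-geometric inequality
    |a(u) a(v)| <= (a(u)^2 + a(v)^2) / 2 and the fact that the kernel H has
    total mass 2 pi in each variable. *)
Let abel_r2_le : ((\int[mu]_x (abel e x * r x ^+ 2))%:E <=
  (2 * pi)%:E * \int[mu]_u (a u ^+ 2)%:E)%E.
Proof.
have ma2 : measurable_fun [set: measurableTypeR R] (fun u => a u ^+ 2).
  exact: measurable_funX.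
have mGv v : measurable_fun [set: measurableTypeR R] (G^~ v).
  exact: (measurableT_comp mG (pair2_measurable v)).
have mHv v : measurable_fun [set: measurableTypeR R] (H^~ v).
  exact: (measurableT_comp mH (pair2_measurable v)).
have mHu u : measurable_fun [set: measurableTypeR R] (H u).
  exact: (measurableT_comp mH (pair1_measurable u)).
have mGs : measurable_fun [set: measurableTypeR R * measurableTypeR R]
    (fun z => G z.2 z.1).
  exact: (measurable_fun_swap mG).
have mHs : measurable_fun [set: measurableTypeR R * measurableTypeR R]
    (fun z => H z.2 z.1).
  exact: (measurable_fun_swap mH).
pose q v := \int[mu]_u (a u * G u v).
have mq : measurable_fun [set: measurableTypeR R] q.
  apply: (@measurable_Rintegral_param _ _ _ _ _ mu (fun v u => a u * G u v)).
  apply: measurable_funM; first exact: measurableT_comp.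
  exact: mGs.
pose A u v := 2^-1 * a u ^+ 2 * H u v; pose B u v := 2^-1 * a v ^+ 2 * H u v.
have A0 u v : 0 <= A u v 
  by apply: mulr_ge0 => //; apply: mulr_ge0; rewrite ?invr_ge0 ?sqr_ge0.
have B0 u v : 0 <= B u v 
  by apply: mulr_ge0 => //; apply: mulr_ge0; rewrite ?invr_ge0 ?sqr_ge0.
have mA : measurable_fun [set: measurableTypeR R * measurableTypeR R]
    (fun z => A z.2 z.1).
  apply: measurable_funM; last exact: mHs.
  by apply: measurable_funM => //; exact: (measurableT_comp ma2 measurable_snd).
have mB : measurable_fun [set: measurableTypeR R * measurableTypeR R]
    (fun z => B z.2 z.1).
  apply: measurable_funM; last exact: mHs.
  by apply: measurable_funM => //; exact: (measurableT_comp ma2 measurable_fst).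
have mAv v : measurable_fun [set: measurableTypeR R] (A^~ v).
  exact: (measurableT_comp mA (pair1_measurable v)).
have mBv v : measurable_fun [set: measurableTypeR R] (B^~ v).
  exact: (measurableT_comp mB (pair1_measurable v)).
rewrite abel_r2 -/q.
apply: (@le_trans _ _ (\int[mu]_v `|a v * q v|%:E)%E).
  apply: le_trans (le_normr_Rintegral_abs _ _); first by rewrite lee_fin ler_norm.
  exact: measurable_funM.
apply: (@le_trans _ _ (\int[mu]_v (\int[mu]_u (A u v)%:E + \int[mu]_u (B u v)%:E))%E).
  apply: ge0_le_integral => //.
  - by apply/measurable_EFinP/measurableT_comp => //; exact: measurable_funM.
  - apply: emeasurable_funD.
      exact: (@ge0_measurable_integral_param _ _ _ _ _ mu (fun v u => A u v)).
    exact: (@ge0_measurable_integral_param _ _ _ _ _ mu (fun v u => B u v)).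
  - move=> v _; rewrite -ge0_integralD//; first last.
    + exact/measurable_EFinP.
    + by move=> u _; rewrite lee_fin.
    + exact/measurable_EFinP.
    + by move=> u _; rewrite lee_fin.
    rewrite normrM EFinM.
    apply: (@le_trans _ _ (`|a v|%:E * \int[mu]_u `|a u * G u v|%:E)%E).
      rewrite lee_wpmul2l ?lee_fin//; apply: le_normr_Rintegral_abs.
      exact: measurable_funM.
    rewrite -ge0_integralZl//; last first.
      by apply/measurable_EFinP/measurableT_comp => //; exact: measurable_funM.
    apply: ge0_le_integral => //.
    + apply/measurable_EFinP/measurable_funM => //.
      by apply: measurableT_comp => //; exact: measurable_funM.
    + by apply: emeasurable_funD; exact/measurable_EFinP.
    + move=> u _; rewrite -EFinM -EFinD lee_fin normrM mulrA.
      apply: (@le_trans _ _ (`|a v| * `|a u| * H u v)).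
        by rewrite ler_wpM2l// mulr_ge0.
      rewrite /A /B -mulrDl ler_wpM2r//.
      have := sqr_ge0 (`|a v| - `|a u|).
      by rewrite sqrrB !real_normK ?num_real// => h; lra.
rewrite ge0_integralD//; first last.
- exact: (@ge0_measurable_integral_param _ _ _ _ _ mu (fun v u => B u v)).
- by move=> v _; apply: integral_ge0 => u _; rewrite lee_fin.
- exact: (@ge0_measurable_integral_param _ _ _ _ _ mu (fun v u => A u v)).
- by move=> v _; apply: integral_ge0 => u _; rewrite lee_fin.
rewrite (@ge0_integral_exchange _ _ _ _ _ mu mu (fun v u => A u v))//.
have half : (\int[mu]_u ((2^-1 * a u ^+ 2)%:E * (2 * pi)%:E) =
    pi%:E * \int[mu]_u (a u ^+ 2)%:E)%E.
  rewrite -ge0_integralZl//.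
  - by apply: eq_integral => u _; rewrite -!EFinM; congr EFin; field.
  - exact/measurable_EFinP.
  - by move=> u _; rewrite lee_fin sqr_ge0.
  - by rewrite lee_fin pi_ge0.
have -> : (\int[mu]_u \int[mu]_v (A u v)%:E = pi%:E * \int[mu]_u (a u ^+ 2)%:E)%E.
  rewrite -half; apply: eq_integral => u _; rewrite -(integral_H u).
  rewrite -ge0_integralZl//.
  - apply: eq_integral => v _; rewrite -EFinM /A; congr EFin; congr (_ * _).
    by rewrite /H addrC [v + u]addrC -[v - u]opprB poissonN addrC.
  - exact/measurable_EFinP.
  - by move=> v _; rewrite lee_fin.
  - by rewrite lee_fin mulr_ge0 ?sqr_ge0.
have -> : (\int[mu]_v \int[mu]_u (B u v)%:E = pi%:E * \int[mu]_u (a u ^+ 2)%:E)%E.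
  rewrite -half; apply: eq_integral => v _; rewrite -(integral_H v).
  rewrite -ge0_integralZl//.
  - exact/measurable_EFinP.
  - by move=> u _; rewrite lee_fin.
  - by rewrite lee_fin mulr_ge0 ?sqr_ge0.
rewrite -ge0_muleDl ?lee_fin ?pi_ge0// -EFinD.
by rewrite (_ : pi + pi = 2 * pi)//; ring.
Qed.

Lemma integral_abel_cos_transform2_le :
  (\int[mu]_x (abel e x * cos_transform s a x ^+ 2)%:E <=
   (2 * pi)%:E * \int[mu]_u (a u ^+ 2)%:E)%E.
Proof.
apply: le_trans abel_r2_le; rewrite /Rintegral fineK//.
apply: integrable_fin_num => //.
apply: integrableM_bounded (N ^+ 2) (integrable_abel e0) _ _.
  by apply: measurable_funX; exact: measurable_cos_transform.
by move=> x; rewrite normrX lerXn2r// nnegrE// (le_trans _ (r_le 0)).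
Qed.

End kernel_bound.

End Plancherel.

Section PlancherelLimit.
Context {R : realType}.
Let mu := @lebesgue_measure R.

(** The Abel weight exp(-e|x|) makes all integrals absolutely convergent and
    turns the square into a quadratic form with a Poisson kernel, bounded by
    Schur's test uniformly in e; the weight is removed by monotone convergence.
    This is the half of Plancherel's theorem that bounds errors from above. *)
Lemma plancherel_le (s : R) (a : R -> R) : mu.-integrable setT (EFin \o a) ->
  (\int[mu]_x (cos_transform s a x ^+ 2)%:E <=
   (2 * pi)%:E * \int[mu]_u (a u ^+ 2)%:E)%E.
Proof.
move=> ia; pose en (n : nat) : R := n.+1%:R^-1.
have en0 n : 0 < en n by rewrite invr_gt0.
pose g n x := (abel (en n) x * cos_transform s a x ^+ 2)%:E.
have mr2 : measurable_fun [set: measurableTypeR R]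
    (fun x => cos_transform s a x ^+ 2).
  by apply: measurable_funX; exact: measurable_cos_transform.
have cg : (\int[mu]_x g n x)%E @[n --> \oo] -->
    (\int[mu]_x (cos_transform s a x ^+ 2)%:E)%E.
  rewrite [X in _ --> X](_ : _ = \int[mu]_x limn (g^~ x))%E; last first.
    apply: eq_integral => x _; apply/esym/cvg_lim => //.
    apply: cvg_EFin; first exact: nearW.
    rewrite /comp /= -[X in _ --> X]mul1r; apply: cvgM; last exact: cvg_cst.
    rewrite -expR0.
    apply: (@cvg_comp _ _ _ (fun n => - en n * `|x|) expR _ _ _ _ (@continuous_expR R 0)).
    rewrite -(mul0r `|x|); apply: cvgM; last exact: cvg_cst.
    by rewrite -oppr0; apply: cvgN; exact: cvg_harmonic.
  apply: cvg_monotone_convergence => //.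
  - move=> n; apply/measurable_EFinP/measurable_funM => //.
    exact: (continuous_measurable_fun (@continuous_abel R (en n))).
  - by move=> n x _; rewrite lee_fin mulr_ge0 ?abel_ge0 ?sqr_ge0.
  - move=> x _ i j ij; rewrite lee_fin ler_wpM2r ?sqr_ge0// ler_expR.
    rewrite ler_wpM2r// lerN2 lef_pV2 ?posrE// ler_nat//.
rewrite -(cvg_lim _ cg)//; apply: lime_le; first by apply/cvg_ex; eexists; exact: cg.
by apply: nearW => n; exact: integral_abel_cos_transform2_le.
Qed.

End PlancherelLimit.

(** * Fourier inversion *)

Section Inversion.
Context {R : realType}.
Let mu := @lebesgue_measure R.
Variable f : R -> R.
Hypothesis fi : mu.-integrable setT (EFin \o f).
Let a := cos_transform 0 f.
Let b := cos_transform (pi / 2) f.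
Hypothesis ai : mu.-integrable setT (EFin \o a).
Hypothesis bi : mu.-integrable setT (EFin \o b).

Definition inverse_transform (a b : R -> R) (x : R) : R :=
  (2 * pi)^-1 * (cos_transform 0 a x + cos_transform (pi / 2) b x).

Let mf : measurable_fun [set: measurableTypeR R] f.
Proof. by have /measurable_EFinP := measurable_int _ fi. Qed.
Let ma : measurable_fun [set: measurableTypeR R] a.
Proof. by have /measurable_EFinP := measurable_int _ ai. Qed.
Let mb : measurable_fun [set: measurableTypeR R] b.
Proof. by have /measurable_EFinP := measurable_int _ bi. Qed.

Let ab_shift u x : a u * cos (u * x - 0) + b u * cos (u * x - pi / 2) =
  \int[mu]_y (f y * cos (u * (y - x))).
Proof.
rewrite /a /b /cos_transform mulrC [X in _ + X]mulrC.
rewrite -!RintegralZl//; [|exact: integrable_Mcos..].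
rewrite -RintegralD//; [|by apply: integrable_scale; exact: integrable_Mcos..].
apply: eq_Rintegral => y _; rewrite !subr0 !cosBpihalf mulrBr cosB.
by rewrite [u * y]mulrC; ring.
Qed.

(** Fubini's theorem moves the Abel weight onto cos(u (y - x)), and the Abel
    integral of that phase is the Poisson kernel at y - x. *)
Let abel_mean e x : 0 < e ->
  \int[mu]_u (abel e u * (a u * cos (u * x - 0) + b u * cos (u * x - pi / 2))) =
  \int[mu]_y (f y * poisson e (y - x)).
Proof.
move=> e0; have ie := integrable_abel e0.
have iy u : mu.-integrable setT (EFin \o (fun y => f y * cos (u * (y - x)))).
  apply: integrableM_bounded (1) fi _ _ => [|y]; last exact: cos_max.
  under eq_fun do rewrite mulrBr.
  exact: measurable_cos_phase1.
transitivity (\int[mu]_u \int[mu]_y (abel e u * (f y * cos (u * (y - x))))).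
  by apply: eq_Rintegral => u _; rewrite ab_shift RintegralZl.
rewrite (@Rintegral_exchange _ _ _ _ _ mu mu _ (abel e) (fun y => `|f y|))//.
- apply: eq_Rintegral => y _.
  have iabel : mu.-integrable setT
      (EFin \o (fun u => abel e u * cos ((y - x) * u - 0))).
    apply: integrable_abelM => // [|u]; last exact: cos_max.
    exact: measurable_cos_phase1.
  have := Rintegral_abel_cos_phase e0 (y - x) 0; rewrite cos0 mul1r => <-.
  rewrite -RintegralZl//; apply: eq_Rintegral => u _.
  by rewrite subr0 [(y - x) * u]mulrC; ring.
- apply: measurable_funM.
    apply: (measurableT_comp (continuous_measurable_fun (@continuous_abel R e))).
    exact: measurable_fst.
  apply: measurable_funM; first exact: measurableT_comp.
  apply: (measurableT_comp (continuous_measurable_fun (@continuous_cos R))) => /=.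
  apply: measurable_funM => //; apply: measurable_funB => //.
- exact: integrable_norm.
- move=> u y; rewrite normrM (ger0_norm (abel_ge0 _ _)) ler_wpM2l ?abel_ge0//.
  by rewrite normrM ler_piMr// cos_max.
Qed.

Let mean e x :=
  \int[mu]_u (abel e u * (a u * cos (u * x - 0) + b u * cos (u * x - pi / 2))).

Let integral_mean e c d : 0 < e -> c < d ->
  \int[mu]_(x in `[c, d]) mean e x =
  \int[mu]_y (f y * (2 * (atan ((d - y) / e) - atan ((c - y) / e)))).
Proof.
move=> e0 cd; rewrite Rintegral_indic_mkcond.
have mP := continuous_measurable_fun (continuous_poisson e0).
have mPx x : measurable_fun [set: measurableTypeR R] (fun y => poisson e (y - x)).
  by apply: (measurableT_comp mP); exact: measurable_funB.
have mPy y : measurable_fun [set: measurableTypeR R] (fun x => poisson e (y - x)).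
  by apply: (measurableT_comp mP); exact: measurable_funB.
have P_le w : `|poisson e w| <= 2 / e.
  by rewrite ger0_norm ?poisson_ge0// poisson_le.
have m1 : measurable_fun [set: measurableTypeR R] (\1_(`[c, d]%classic) : R -> R).
  exact: measurable_indic.
have i1 : mu.-integrable setT (EFin \o \1_(`[c, d]%classic : set R)).
  exact: integrable_indic_itv.
transitivity (\int[mu]_x \int[mu]_y (\1_`[c, d] x * (f y * poisson e (y - x)))).
  apply: eq_Rintegral => x _; rewrite /mean abel_mean// RintegralZl//.
  exact: integrableM_bounded fi (mPx x) (fun y => P_le _).
rewrite (@Rintegral_exchange _ _ _ _ _ mu mu _ \1_(`[c, d]%classic : set R)
  (fun y => `|f y| * (2 / e)))//.
- apply: eq_Rintegral => y _; rewrite -Rintegral_poisson_itv//.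
  rewrite [in RHS]Rintegral_indic_mkcond -RintegralZl//.
    by apply: eq_Rintegral => x _; ring.
  exact: integrableM_bounded i1 (mPy y) (fun x => P_le _).
- apply: measurable_funM.
    exact: (measurableT_comp m1 measurable_fst).
  apply: measurable_funM; first exact: measurableT_comp.
  by apply: (measurableT_comp mP); exact: measurable_funB.
- apply: integrableM_bounded (2 / e) (integrable_norm fi) _ _ => // y.
  by rewrite ger0_norm// divr_ge0// ltW.
- move=> x y; rewrite normrM ger0_norm// ler_wpM2l// normrM.
  by rewrite ler_wpM2l// P_le.
Qed.

Let f0 x := cos_transform 0 a x + cos_transform (pi / 2) b x.

Let en (n : nat) : R := n.+1%:R^-1.
Let en0 n : 0 < en n. Proof. by rewrite invr_gt0. Qed.

Let f0_integrand x : mu.-integrable setT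
  (EFin \o (fun u => a u * cos (u * x - 0) + b u * cos (u * x - pi / 2))).
Proof. exact: integrableD (integrable_Mcos _ _ ai) (integrable_Mcos _ _ bi). Qed.

Let f0E x :
  f0 x = \int[mu]_u (a u * cos (u * x - 0) + b u * cos (u * x - pi / 2)).
Proof. by rewrite RintegralD//; exact: integrable_Mcos. Qed.

Let N := \int[mu]_u (`|a u| + `|b u|).

Let f0_dom x u :
  `|a u * cos (u * x - 0) + b u * cos (u * x - pi / 2)| <= `|a u| + `|b u|.
Proof.
rewrite (le_trans (ler_normD _ _))// !normrM lerD// ler_piMr// cos_max//.
Qed.

Let iab : mu.-integrable setT (EFin \o (fun u => `|a u| + `|b u|)).
Proof. exact: integrableD (integrable_norm ai) (integrable_norm bi). Qed.

Let f0_le x : `|f0 x| <= N.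
Proof.
rewrite f0E (le_trans (le_normr_Rintegral measurableT (f0_integrand x)))//.
by apply: le_Rintegral => //; exact: integrable_norm (f0_integrand x).
Qed.

Let mean_integrand e x : 0 < e -> mu.-integrable setT (EFin \o (fun u =>
  abel e u * (a u * cos (u * x - 0) + b u * cos (u * x - pi / 2)))).
Proof.
move=> e0; under eq_fun do rewrite mulrC.
apply: integrableM_bounded (1) (f0_integrand x) _ _ => [|u].
  exact: (continuous_measurable_fun (@continuous_abel R e)).
by rewrite ger0_norm ?abel_ge0// expR_le1 mulNr oppr_le0 mulr_ge0// ltW.
Qed.

Let mean_dom e x u : 0 < e ->
  `|abel e u * (a u * cos (u * x - 0) + b u * cos (u * x - pi / 2))| <=
  `|a u| + `|b u|.
Proof.
move=> e0; rewrite normrM (le_trans _ (f0_dom x u))// ler_piMl//.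
by rewrite ger0_norm ?abel_ge0// expR_le1 mulNr oppr_le0 mulr_ge0// ltW.
Qed.

Let mean_le e x : 0 < e -> `|mean e x| <= N.
Proof.
move=> e0.
rewrite (le_trans (le_normr_Rintegral measurableT (mean_integrand x e0)))//.
apply: le_Rintegral => //; first exact: integrable_norm (mean_integrand x e0).
by move=> u _; exact: mean_dom.
Qed.

Let cvg_mean x : mean (en n) x @[n --> \oo] --> f0 x.
Proof.
rewrite f0E; apply: Rintegral_dominated_cvg iab _ => //.
- by move=> n; have /measurable_EFinP := measurable_int _ (mean_integrand x (en0 n)).
- move=> u _; rewrite -[X in _ --> X]mul1r; apply: cvgM; last exact: cvg_cst.
  rewrite -expR0.
  apply: (@cvg_comp _ _ _ (fun n => - en n * `|u|) expR _ _ _ _ (@continuous_expR R 0)).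
  rewrite -(mul0r `|u|); apply: cvgM; last exact: cvg_cst.
  by rewrite -oppr0; apply: cvgN; exact: cvg_harmonic.
- by move=> n u _; exact: mean_dom.
Qed.

Let mmean e : measurable_fun [set: measurableTypeR R] (mean e).
Proof.
apply: (@measurable_Rintegral_param _ _ _ _ _ mu (fun x u =>
   abel e u * (a u * cos (u * x - 0) + b u * cos (u * x - pi / 2)))).
have mc s : measurable_fun [set: measurableTypeR R * measurableTypeR R]
    (fun z => cos (z.2 * z.1 - s) : R).
  by under eq_fun do rewrite mulrC; exact: measurable_cos_phase.
apply: measurable_funM.
  apply: (measurableT_comp (continuous_measurable_fun (@continuous_abel R e))).
  exact: measurable_snd.
by apply: measurable_funD; apply: measurable_funM; (exact: mc ||
  exact: (measurableT_comp ma measurable_snd) ||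
  exact: (measurableT_comp mb measurable_snd)).
Qed.

Let mf0 : measurable_fun [set: measurableTypeR R] f0.
Proof.
by apply: measurable_funD; exact: measurable_cos_transform.
Qed.

(** Up to normalization and the constant pi/2, this is the Poisson mass of a
    half-line, which tends to 1, 1/2 or 0. *)
Let cvg_atan_en t : atan (t / en n) @[n --> \oo] --> Num.sg t * (pi / 2).
Proof.
have pos s : 0 < s -> atan (s / en n) @[n --> \oo] --> pi / 2.
  move=> s0; apply: (@cvg_comp _ _ _ (fun n => s / en n) atan _ _ _ _ (@cvgy_atan R)).
  apply/cvgryPge => A; near=> n; rewrite /en invrK -ler_pdivrMl//.
  rewrite (@le_trans _ _ n%:R)// ?ler_nat//.
  by near: n; exact: nbhs_infty_ger.
have [t0|t0|->] := ltgtP t 0.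
- rewrite ltr0_sg// mulN1r -[t]opprK.
  under eq_fun do rewrite mulNr atanN.
  by apply: cvgN; apply: pos; rewrite oppr_gt0.
- by rewrite gtr0_sg// mul1r; exact: pos.
- by rewrite sgr0 mul0r; under eq_fun do rewrite mul0r atan0; exact: cvg_cst.
Unshelve. all: by end_near. Qed.

(** Both sides are limits of the integral of the Abel means over [c, d]: on the
    left the weight tends to 1, on the right the Poisson mass of [c, d] seen from
    y tends to the indicator of [c, d] except at the two endpoints. *)
Let integral_f0 c d : c < d ->
  \int[mu]_(x in `[c, d]) f0 x = \int[mu]_(y in `[c, d]) (2 * pi * f y).
Proof.
move=> cd.
have matan z n : measurable_fun [set: measurableTypeR R]
    (fun y => atan ((z - y) / en n) : R).
  apply: (measurableT_comp (continuous_measurable_fun (@continuous_atan R))).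
  by apply: measurable_funM => //; exact: measurable_funB.
have c1 : \int[mu]_(x in `[c, d]) mean (en n) x @[n --> \oo] -->
    \int[mu]_(x in `[c, d]) f0 x.
  apply: (@Rintegral_dominated_cvg _ _ _ _ _ _ _ (cst N)) => //.
  - by move=> n; exact: measurable_funTS.
  - apply: measurable_bounded_integrable => //.
      by rewrite /= lebesgue_measure_itv/= lte_fin cd ltry.
    by exists `|N|; split => [|M /ltW NM x _]; rewrite ?num_real.
  - by move=> n x _; exact: mean_le.
have c2 : \int[mu]_(x in `[c, d]) mean (en n) x @[n --> \oo] -->
    \int[mu]_y (f y * (pi * (Num.sg (d - y) - Num.sg (c - y)))).
  under eq_fun do rewrite integral_mean//.
  apply: (@Rintegral_dominated_cvg _ _ _ mu setT
    (fun n y => f y * (2 * (atan ((d - y) / en n) - atan ((c - y) / en n))))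
    _ (fun y => `|f y| * (2 * pi))) => //.
  - move=> n; apply: measurable_funM => //; apply: measurable_funM => //.
    by apply: measurable_funB; exact: matan.
  - move=> y _; apply: cvgM; first exact: cvg_cst.
    rewrite (_ : pi * _ = 2 * (Num.sg (d - y) * (pi / 2) - Num.sg (c - y) * (pi / 2))).
      by apply: cvgM; [exact: cvg_cst|apply: cvgB; exact: cvg_atan_en].
    by field.
  - by apply: integrableM_bounded (2 * pi) (integrable_norm fi) _ _ => // y;
      rewrite ger0_norm// mulr_ge0// pi_ge0.
  - move=> n y _; rewrite normrM ler_wpM2l// normrM ger0_norm// ler_wpM2l//.
    have h z := atan_gtNpi2 ((z - y) / en n); have h' z := atan_ltpi2 ((z - y) / en n).
    by rewrite ler_norml; have := h c; have := h d; have := h' c; have := h' d; lra.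
rewrite -(cvg_lim _ c1)// (cvg_lim _ c2)//.
rewrite [RHS]Rintegral_mkcond /Rintegral; congr fine.
have mind : measurable_fun [set: measurableTypeR R]
    (fun y => pi * (Num.sg (d - y) - Num.sg (c - y)) : R).
  have msg z : measurable_fun [set: measurableTypeR R] (fun y => Num.sg (z - y) : R).
    apply: (@measurable_fun_cvg _ (measurableTypeR R) R setT (fun n y => 2 / pi * atan ((z - y) / en n))).
      by move=> n; apply: measurable_funM => //; exact: matan.
    move=> y _; rewrite (_ : Num.sg _ = 2 / pi * (Num.sg (z - y) * (pi / 2))).
      by apply: cvgM; [exact: cvg_cst|exact: cvg_atan_en].
    have : (pi : R) != 0 by rewrite gt_eqF // pi_gt0.
    by move: (pi : R) => p p0; field.
  by apply: measurable_funM => //; exact: measurable_funB.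
apply: ae_eq_integral => //.
- by apply/measurable_EFinP; exact: measurable_funM.
- apply/measurable_EFinP; apply/(measurable_restrictT _ _).1 => //.
  by apply: measurable_funTS; exact: measurable_funM.
exists [set c; d]; split => //.
- exact: measurableU.
- exact/countable_lebesgue_measure0/finite_set_countable/finite_set2.
- move=> y /= /not_implyP[_]; apply: contra_notP => ycd; rewrite patchE.
  congr EFin; have [yc|cy|yc] := ltgtP y c; last by case: ycd; left.
    rewrite memNset /= ?in_itv/= ?(lt_geF yc)// !gtr0_sg ?subr_gt0//.
      by rewrite subrr !mulr0.
    exact: lt_trans yc cd.
  rewrite [Num.sg (c - y)]ltr0_sg ?subr_lt0//.
  have [yd|dy|yd] := ltgtP y d; last by case: ycd; right.
    rewrite mem_set /= ?in_itv/= ?(ltW yd) ?(ltW cy)// gtr0_sg ?subr_gt0//.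
    by ring.
  rewrite memNset /= ?in_itv/= ?(lt_geF dy) ?andbF// ltr0_sg ?subr_lt0//.
  by rewrite subrr !mulr0.
Qed.

(** Lévy's inversion formula, by Abel summation: the Abel means of the inverse
    Fourier integral are Poisson means of f; integrating both over [c, d] and
    removing the weight shows that f and the inverse integral have the same
    integral over every interval, hence agree almost everywhere. *)
Lemma fourier_inversion_ae :
  {ae mu, forall x, f x = inverse_transform a b x}.
Proof.
pose h x := 2 * pi * f x - f0 x.
have i0 c d : mu.-integrable `[c, d] (EFin \o f0).
  apply: measurable_bounded_integrable => //.
  - by rewrite /= lebesgue_measure_itv/=; case: ifPn => _; rewrite ltry.
  - exact: measurable_funTS.
  - exists N; split => [|M NM x _]; rewrite ?num_real//.
    by rewrite /= (le_trans (f0_le x))// ltW.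
have i1 c d : mu.-integrable `[c, d] (EFin \o (fun x => 2 * pi * f x)).
  apply: (integrableS _ _ (@subsetT _ _)) => //; exact: integrable_scale.
have ih c d : mu.-integrable `[c, d] (EFin \o h).
  exact: integrableB (i1 c d) (i0 c d).
have loch : locally_integrable [set: R] h.
  apply: locally_integrableB.
    apply: open_integrable_locally; first exact: openT.
    exact: integrable_scale.
  split; [exact: mf0|exact: openT|move=> K _ cK].
  have mK := compact_measurable cK.
  apply: (@le_lt_trans _ _ (\int[mu]_(x in K) N%:E)%E).
    apply: ge0_le_integral => //.
    - by apply/measurable_EFinP/measurableT_comp => //; exact: measurable_funTS.
    - by move=> x _; rewrite lee_fin f0_le.
  rewrite integral_cst// lte_mul_pinfty ?lee_fin//.
    exact: le_trans (f0_le 0).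
  exact: compact_finite_measure.
have int_h c d : \int[mu]_(x in `[c, d]) h x = 0.
  have [cd|dc|<-] := ltgtP c d.
  - by rewrite RintegralB// integral_f0// subrr.
  - by rewrite set_itv_ge ?bnd_simp -?ltNge// Rintegral_set0.
  - by rewrite set_itv1 Rintegral_set1.
(* the primitive of h vanishes, hence so does its derivative h almost
   everywhere; the half-lines exhaust R *)
have aeN (n : nat) : {ae mu, forall x, - n%:R < x -> h x = 0}.
  have := @FTC1 R h (BLeft (- n%:R)) (fun y => ih _ y) loch.
  rewrite (_ : (fun x => _) = cst 0); last by apply/funext => x; exact: int_h.
  apply: filterS; first exact: (ae_filter_ringOfSetsType mu).
  move=> x /= + nx; rewrite lte_fin nx => /(_ isT)[_].
  by rewrite derive1_cst.
have := ae_foralln aeN; apply: filterS => x hx.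
have : h x = 0.
  apply: (hx (Num.bound `|x|)); rewrite ltrNl.
  by rewrite (le_lt_trans _ (archi_boundP (normr_ge0 x)))// -normrN ler_norm.
move=> /subr0_eq; rewrite /inverse_transform -/(f0 x) => <-.
by rewrite mulKf// gt_eqF// mulr_gt0// pi_gt0.
Qed.

End Inversion.

(** * The estimator in Fourier space *)

Section EstimatorInFourierSpace.
Local Open Scope complex_scope.
Context {R : realType}.
Let mu := @lebesgue_measure R.

Lemma cexp_imag (y : R) : cexp (y *i) = cos y +i* sin y.
Proof. by rewrite /cexp /= expR0 mul1r. Qed.

Lemma measurable_inverse_transform (a b : R -> R) :
  mu.-integrable setT (EFin \o a) -> mu.-integrable setT (EFin \o b) ->
  measurable_fun [set: measurableTypeR R] (inverse_transform a b).
Proof.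
move=> ai bi; apply: measurable_funM => //.
by apply: measurable_funD; exact: measurable_cos_transform.
Qed.

Lemma cos_transformB s (g h : R -> R) x :
  mu.-integrable setT (EFin \o g) -> mu.-integrable setT (EFin \o h) ->
  cos_transform s (fun u => g u - h u) x = cos_transform s g x - cos_transform s h x.
Proof.
move=> gi hi; rewrite /cos_transform -RintegralB//; [|exact: integrable_Mcos..].
by apply: eq_Rintegral => u _; rewrite mulrBl.
Qed.

Lemma inverse_transformB (a b a' b' : R -> R) x :
  mu.-integrable setT (EFin \o a) -> mu.-integrable setT (EFin \o b) ->
  mu.-integrable setT (EFin \o a') -> mu.-integrable setT (EFin \o b') ->
  inverse_transform (fun u => a u - a' u) (fun u => b u - b' u) x =
  inverse_transform a b x - inverse_transform a' b' x.
Proof.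
by move=> ai bi a'i b'i; rewrite /inverse_transform !cos_transformB//; ring.
Qed.

(** The cosine and the sine part are bounded separately by Plancherel's
    inequality; (x + y)^2 <= 2 (x^2 + y^2) costs a factor 2. *)
Lemma integral_inverse_transform2_le (a b : R -> R) :
  mu.-integrable setT (EFin \o a) -> mu.-integrable setT (EFin \o b) ->
  (\int[mu]_x (inverse_transform a b x ^+ 2)%:E <=
   pi^-1%:E * (\int[mu]_u (a u ^+ 2)%:E + \int[mu]_u (b u ^+ 2)%:E))%E.
Proof.
move=> ai bi.
have mt s (g : R -> R) : mu.-integrable setT (EFin \o g) ->
    measurable_fun [set: measurableTypeR R] (fun x => cos_transform s g x ^+ 2).
  by move=> gi; apply: measurable_funX; exact: measurable_cos_transform.
pose c : R := 2 * (2 * pi)^-1 ^+ 2.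
have c0 : 0 <= c by rewrite mulr_ge0// sqr_ge0.
apply: (@le_trans _ _ (c%:E * (\int[mu]_x (cos_transform 0 a x ^+ 2)%:E +
    \int[mu]_x (cos_transform (pi / 2) b x ^+ 2)%:E))%E).
  rewrite -ge0_integralD//; first last.
  - by apply/measurable_EFinP; exact: mt.
  - by move=> x _; rewrite lee_fin sqr_ge0.
  - by apply/measurable_EFinP; exact: mt.
  - by move=> x _; rewrite lee_fin sqr_ge0.
  rewrite -ge0_integralZl//; first last.
  - by move=> x _; rewrite -EFinD lee_fin addr_ge0// sqr_ge0.
  - by apply: emeasurable_funD; apply/measurable_EFinP; exact: mt.
  apply: ge0_le_integral => //.
  - by move=> x _; rewrite lee_fin sqr_ge0.
  - apply/measurable_EFinP/measurable_funX.
    exact: measurable_inverse_transform.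
  - apply: measurable_funeM.
    by apply: emeasurable_funD; apply/measurable_EFinP; exact: mt.
  - move=> x _; rewrite -EFinD -EFinM lee_fin /inverse_transform exprMn /c.
    set A := cos_transform 0 a x; set B := cos_transform (pi / 2) b x.
    move: ((2 * pi)^-1 : R) => k.
    rewrite [leRHS](_ : _ = k ^+ 2 * (2 * (A ^+ 2 + B ^+ 2))); last by ring.
    rewrite ler_wpM2l ?sqr_ge0//.
    by have := sqr_ge0 (A - B); rewrite sqrrB sqrrD => h; lra.
rewrite (_ : pi^-1%:E = c%:E * (2 * pi)%:E)%E; last first.
  have p0 : (pi : R) != 0 by rewrite gt_eqF// pi_gt0.
  by rewrite -EFinM /c; congr EFin; move: (pi : R) p0 => p p0; field.
rewrite -muleA lee_wpmul2l ?lee_fin//.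
rewrite ge0_muleDr ?integral_ge0//; last 2 first.
- by move=> x _; rewrite lee_fin sqr_ge0.
- by move=> x _; rewrite lee_fin sqr_ge0.
by apply: leeD; exact: plancherel_le.
Qed.

Section sample.
Variables (n : nat) (m : R) (z : 'I_n -> R).

(** Real and imaginary part of the empirical characteristic function, for the
    phases 0 and pi/2. *)
Definition emp_cos (s u : R) : R := n%:R^-1 * \sum_(j < n) cos (u * z j - s).

Definition cut_emp_cos (s u : R) : R := \1_`[- m, m] u * emp_cos s u.

Lemma emp_char_funE u : emp_char_fun z u = emp_cos 0 u +i* emp_cos (pi / 2) u.
Proof.
rewrite /emp_char_fun /emp_cos.
under eq_bigr do rewrite cexp_imag.
under [in RHS]eq_bigr do rewrite subr0.
under [X in _ +i* (_ * X)]eq_bigr do rewrite cosBpihalf.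
have -> : \sum_(j < n) (cos (u * z j) +i* sin (u * z j)) =
    (\sum_(j < n) cos (u * z j)) +i* (\sum_(j < n) sin (u * z j)).
  by elim/big_rec3: _ => // j x1 x2 x3 _ ->.
by rewrite /GRing.mul /= !mul0r subr0 addr0.
Qed.

Let measurable_emp_cos s : measurable_fun [set: measurableTypeR R] (emp_cos s).
Proof.
apply: measurable_funM => //; apply: measurable_sum => j.
under eq_fun do rewrite mulrC.
exact: measurable_cos_phase1.
Qed.

Lemma emp_cos_le1 s u : `|emp_cos s u| <= 1.
Proof.
rewrite /emp_cos; case: n z => [|k] y; first by rewrite big_ord0 mulr0 normr0.
rewrite normrM ger0_norm ?invr_ge0// ler_pdivrMl// mulr1.
rewrite (le_trans (ler_norm_sum _ _ _))//.
rewrite (le_trans (ler_sum _ (fun j _ => cos_max _)))//.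
by rewrite sumr_const card_ord.
Qed.

Lemma integrable_cut_emp_cos s : mu.-integrable setT (EFin \o cut_emp_cos s).
Proof.
have i1 : mu.-integrable setT (EFin \o \1_(`[- m, m]%classic : set R)).
  exact: integrable_indic_itv.
exact: integrableM_bounded i1 (measurable_emp_cos s) (emp_cos_le1 s).
Qed.

(** The estimator is real because the imaginary part of its integrand is odd. *)
Lemma density_estimatorE x : density_estimator m z x =
  (inverse_transform (cut_emp_cos 0) (cut_emp_cos (pi / 2)) x)%:C.
Proof.
have prodE u : emp_char_fun z u * cexp ((- (u * x)) *i) =
    (emp_cos 0 u * cos (u * x) + emp_cos (pi / 2) u * sin (u * x)) +i*
    (emp_cos (pi / 2) u * cos (u * x) - emp_cos 0 u * sin (u * x)).
  rewrite emp_char_funE cexp_imag cosN sinN /GRing.mul /= !mulrN opprK.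
  by congr (_ +i* _); rewrite addrC.
have icut s t : mu.-integrable setT
    (EFin \o (fun u => cut_emp_cos s u * cos (u * x - t))).
  exact: integrable_Mcos (integrable_cut_emp_cos s).
rewrite /density_estimator.
have -> : cintegral mu `[- m, m] (fun u => emp_char_fun z u * cexp ((- (u * x)) *i)) =
    (cos_transform 0 (cut_emp_cos 0) x +
     cos_transform (pi / 2) (cut_emp_cos (pi / 2)) x)%:C.
  rewrite /cintegral; congr (_ +i* _).
    rewrite Rintegral_indic_mkcond /cos_transform -RintegralD//.
    apply: eq_Rintegral => u _; rewrite prodE /= /cut_emp_cos subr0 cosBpihalf.
    by ring.
  rewrite Rintegral_indic_mkcond.
  have -> : (fun u => \1_`[- m, m] u *
      complex.Im (emp_char_fun z u * cexp ((- (u * x)) *i))) =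
      (fun u => cut_emp_cos (pi / 2) u * cos (u * x - 0) -
                cut_emp_cos 0 u * cos (u * x - pi / 2)).
    apply/funext => u; rewrite prodE /= /cut_emp_cos subr0 cosBpihalf; ring.
  apply: Rintegral_odd => [|u].
    exact: integrableB (icut _ _) (icut _ _).
  have indN : \1_`[- m, m] (- u) = \1_`[- m, m] u :> R.
    rewrite !indicE; congr (nat_of_bool _)%:R.
    by rewrite !mem_setE !in_itv /= lerN2 lerNl andbC.
  have emp0N : emp_cos 0 (- u) = emp_cos 0 u.
    by rewrite /emp_cos; congr (_ * _); apply: eq_bigr => j _;
      rewrite !subr0 mulNr cosN.
  have emp1N : emp_cos (pi / 2) (- u) = - emp_cos (pi / 2) u.
    rewrite /emp_cos -[RHS]mulrN -sumrN; congr (_ * _); apply: eq_bigr => j _.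
    by rewrite !cosBpihalf mulNr sinN.
  rewrite /cut_emp_cos indN emp0N emp1N !subr0 !cosBpihalf mulNr cosN sinN; ring.
by rewrite /inverse_transform /GRing.mul /= !mulr0 !mul0r subr0 addr0.
Qed.


Variable f : R -> R.
Let a := cos_transform 0 f.
Let b := cos_transform (pi / 2) f.
Hypothesis fi : mu.-integrable setT (EFin \o f).
Hypothesis ai : mu.-integrable setT (EFin \o a).
Hypothesis bi : mu.-integrable setT (EFin \o b).

Let poweR2 (x : \bar R) : (0 <= x -> x `^ 2 = x ^+ 2)%E.
Proof.
case: x => [r| |]//; rewrite ?lee_fin => r0.
  by rewrite poweR_EFin powR_mulrn// expr2 expe2 -EFinM.
by rewrite poweRyr// expe2 mulyy.
Qed.

Lemma L2norm_sqr (g : R -> R) :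
  (L2norm (fun x => (g x)%:C) ^+ 2 = \int[mu]_x (g x ^+ 2)%:E)%E.
Proof.
rewrite -poweR2; last exact: Lnorm_ge0.
rewrite /L2norm powR_Lnorm//; apply: eq_integral => x _.
rewrite /= /ComplexField.Normc.normc /= expr0n /= addr0 sqrtr_sqr normr_id powR_mulrn//.
by rewrite real_normK ?num_real.
Qed.

(** Integrated squared error is squared error of the characteristic functions,
    up to a constant: the inversion formula makes the error itself an inverse
    Fourier integral. *)
Lemma integrated_squared_error_le :
  (L2norm (fun x => (density_estimator m z x - (f x)%:C)%R) ^+ 2 <=
   pi^-1%:E * (\int[mu]_u ((cut_emp_cos 0 u - a u) ^+ 2)%:E +
               \int[mu]_u ((cut_emp_cos (pi / 2) u - b u) ^+ 2)%:E))%E.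
Proof.
have ci s := integrable_cut_emp_cos s.
pose F x := inverse_transform (cut_emp_cos 0) (cut_emp_cos (pi / 2)) x.
have -> : (fun x => density_estimator m z x - (f x)%:C) = (fun x => (F x - f x)%:C).
  by apply/funext => x; rewrite density_estimatorE rmorphB.
rewrite L2norm_sqr.
apply: le_trans (integral_inverse_transform2_le (integrableB _ (ci 0) ai)
  (integrableB _ (ci (pi / 2)) bi)) => //.
have mf : measurable_fun [set: measurableTypeR R] f.
  by have /measurable_EFinP := measurable_int _ fi.
rewrite (@ge0_ae_eq_integral _ _ _ mu _ _
  (fun x => (inverse_transform (fun u => cut_emp_cos 0 u - a u)
    (fun u => cut_emp_cos (pi / 2) u - b u) x ^+ 2)%:E))//.
- apply/measurable_EFinP/measurable_funX/measurable_funB => //.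
  exact: measurable_inverse_transform.
- apply/measurable_EFinP/measurable_funX; apply: measurable_inverse_transform.
    exact: integrableB (ci 0) ai.
  exact: integrableB (ci (pi / 2)) bi.
- by move=> x _; rewrite lee_fin sqr_ge0.
- by move=> x _; rewrite lee_fin sqr_ge0.
- have := fourier_inversion_ae fi ai bi; apply: filterS.
    exact: (ae_filter_ringOfSetsType mu).
  move=> x fx _.
  by rewrite inverse_transformB// -/a -/b -fx.
Qed.

End sample.
End EstimatorInFourierSpace.

(** * Means of independent identically distributed variables *)

Section Bounded.
Context {d : measure_display} {T : measurableType d} {R : realType}.
Variable P : probability T R.

Lemma integrable_bounded (f : T -> R) (c : R) : measurable_fun setT f ->
  (forall x, `|f x| <= c) -> P.-integrable setT (EFin \o f).
Proof.
move=> mf fc; apply: measurable_bounded_integrable => //.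
  exact: le_lt_trans (probability_le1 P measurableT) (ltry 1).
exists c; split => [|M /ltW cM x _]; first by rewrite num_real.
exact: le_trans (fc x) cM.
Qed.

(** The integral of a nonnegative function is the supremum of the integrals of
    the simple functions below it, hence monotone even on functions not known to
    be measurable, such as the L2 error as a function of the sample point. *)
Lemma ge0_le_integral_nonmeasurable (f g : T -> \bar R) :
  (forall x, 0 <= f x)%E -> (forall x, f x <= g x)%E ->
  (\int[P]_x f x <= \int[P]_x g x)%E.
Proof.
move=> f0 fg; have g0 x : (0 <= g x)%E by exact: le_trans (fg x).
rewrite !ge0_integralTE//; apply: le_ereal_sup => _ [h hf <-].
by exists h => // x; exact: le_trans (hf x) (fg x).
Qed.

Lemma Rintegral_sum_bounded (I : finType) (F : I -> T -> R) (c : R) :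
  (forall i, measurable_fun setT (F i)) -> (forall i x, `|F i x| <= c) ->
  \int[P]_x (\sum_(i : I) F i x) = \sum_(i : I) \int[P]_x F i x.
Proof.
move=> mF Fc; have iF i := integrable_bounded (mF i) (Fc i).
rewrite /Rintegral; under eq_integral => x _ do rewrite -sumEFin.
rewrite integral_sum// sum_fine// => i _; exact: (integrable_fin_num _ (iF i)).
Qed.

Lemma Rintegral_cstP (c : R) : \int[P]_x c = c.
Proof.
rewrite Rintegral_cst// -[RHS]mulr1; congr (_ * _).
by have /= -> := @probability_setT _ _ _ P.
Qed.

(** In the expanded square the off-diagonal terms vanish, the variables being
    uncorrelated, and each of the n diagonal terms is at most 1. *)
Lemma variance_mean_le (n : nat) (Y : 'I_n -> T -> R) (c : R) : (0 < n)%N ->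
  (forall i, measurable_fun setT (Y i)) -> (forall i w, `|Y i w| <= 1) ->
  (forall i, \int[P]_w Y i w = c) ->
  (forall i j, i != j -> \int[P]_w (Y i w * Y j w) = c ^+ 2) ->
  (\int[P]_w ((n%:R^-1 * (\sum_(i < n) Y i w) - c) ^+ 2)%:E <= n%:R^-1%:E)%E.
Proof.
move=> n0 mY Y1 EY EYY.
have nR0 : (0 : R) < n%:R by rewrite ltr0n.
pose Z i w := Y i w - c.
have c1 : `|c| <= 1.
  rewrite -(EY (Ordinal n0)).
  rewrite (le_trans (le_normr_Rintegral measurableT (integrable_bounded (mY _) (Y1 _))))//.
  rewrite -[leRHS]Rintegral_cstP; apply: le_Rintegral => //.
  - exact: integrable_norm (integrable_bounded (mY _) (Y1 _)).
  - by apply: (@integrable_bounded _ 1) => // x; rewrite normr1.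
have mZ i : measurable_fun setT (Z i) by exact: measurable_funB.
have Z2 i w : `|Z i w| <= 2.
  by rewrite (le_trans (ler_normB _ _))// (_ : 2 = 1 + 1)// lerD.
have iY i := integrable_bounded (mY i) (Y1 i).
have mYY i j : measurable_fun setT (fun w => Y i w * Y j w).
  exact: measurable_funM.
have YY1 i j w : `|Y i w * Y j w| <= 1 by rewrite normrM mulr_ile1.
have iYY i j := integrable_bounded (mYY i j) (YY1 i j).
have mZZ i j : measurable_fun setT (fun w => Z i w * Z j w).
  exact: measurable_funM.
have ZZ4 i j w : `|Z i w * Z j w| <= 4.
  by rewrite normrM (_ : 4 = 2 * 2) ?ler_pM//; ring.
have icst (k : R) : P.-integrable setT (EFin \o (fun=> k)).
  by apply: (@integrable_bounded _ `|k|).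
have EZZ i j : \int[P]_w (Z i w * Z j w) = \int[P]_w (Y i w * Y j w) - c ^+ 2.
  transitivity (\int[P]_w ((Y i w * Y j w + c ^+ 2) - (c * Y i w + c * Y j w))).
    by apply: eq_Rintegral => w _; rewrite /Z; ring.
  rewrite RintegralB//; last 2 first.
  - exact: integrableD (iYY i j) (icst _).
  - exact: integrableD (integrable_scale c (iY i)) (integrable_scale c (iY j)).
  rewrite (RintegralD measurableT (iYY i j) (icst (c ^+ 2))) Rintegral_cstP.
  rewrite RintegralD//; [|exact: integrable_scale..].
  by rewrite !RintegralZl// !EY; ring.
have sq w : (n%:R^-1 * (\sum_(i < n) Y i w) - c) ^+ 2 =
    n%:R^-1 ^+ 2 * \sum_(ij : 'I_n * 'I_n) (Z ij.1 w * Z ij.2 w).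
  have -> : n%:R^-1 * (\sum_(i < n) Y i w) - c = n%:R^-1 * \sum_(i < n) Z i w.
    rewrite sumrB sumr_const card_ord -[c *+ n]mulr_natl mulrBr mulKf//.
    by rewrite gt_eqF.
  rewrite exprMn; congr (_ * _); rewrite expr2 big_distrl /=.
  under eq_bigr do rewrite big_distrr /=.
  by rewrite pair_bigA.
have msum : measurable_fun setT
    (fun w => \sum_(ij : 'I_n * 'I_n) (Z ij.1 w * Z ij.2 w)).
  exact: measurable_sum.
have isum : P.-integrable setT
    (EFin \o (fun w => \sum_(ij : 'I_n * 'I_n) (Z ij.1 w * Z ij.2 w))).
  apply: (@integrable_bounded _ (\sum_(ij : 'I_n * 'I_n) 4)) => // w.
  by rewrite (le_trans (ler_norm_sum _ _ _))// ler_sum.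
under eq_integral => w _ do rewrite sq.
rewrite -[leLHS]fineK; last first.
  exact: (integrable_fin_num measurableT (integrable_scale (n%:R^-1 ^+ 2) isum)).
rewrite lee_fin -/(Rintegral _ _ _) RintegralZl//.
rewrite (Rintegral_sum_bounded (c := 4))//.
rewrite -(pair_bigA _ (fun i j => \int[P]_w (Z i w * Z j w)))/=.
apply: (@le_trans _ _ (n%:R^-1 ^+ 2 * \sum_(i < n) 1)).
  rewrite ler_wpM2l ?sqr_ge0//; apply: ler_sum => i _.
  rewrite (bigD1 i)//= big1 ?addr0; last first.
    by move=> j ji; rewrite EZZ EYY ?subrr// eq_sym.
  rewrite EZZ lerBlDr (@le_trans _ _ 1) ?lerDl ?sqr_ge0//.
  rewrite -[leRHS]Rintegral_cstP; apply: le_Rintegral => // w _.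
  by rewrite (le_trans (ler_norm _)).
rewrite sumr_const card_ord expr2 -mulrA mulVf ?mulr1//.
by rewrite gt_eqF.
Qed.

End Bounded.

Section Independence.
Context {d : measure_display} {T : measurableType d} {R : realType}.
Variable P : probability T R.

(** Independence is a statement about events; the joint law of the pair being
    the product of the two laws turns it into a product rule for integrals. *)
Lemma independent_RintegralM (Z1 Z2 : {RV P >-> R}) (g : R -> R) :
  measurable_fun [set: measurableTypeR R] g -> (forall y, `|g y| <= 1) ->
  (forall A B : set R, measurable A -> measurable B ->
     P (Z1 @^-1` A `&` Z2 @^-1` B) = (P (Z1 @^-1` A) * P (Z2 @^-1` B))%E) ->
  \int[P]_w (g (Z1 w) * g (Z2 w)) = (\int[P]_w g (Z1 w)) * (\int[P]_w g (Z2 w)).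
Proof.
move=> mg g1 indep.
pose Z w := (Z1 w, Z2 w).
have mZ : measurable_fun [set: T] Z by exact: measurable_fun_pair.
pose Zm : {mfun T >-> (R * R)%type} :=
  HB.pack Z (isMeasurableFun.Build _ _ _ _ Z mZ).
pose D1 := distribution P Z1; pose D2 := distribution P Z2.
pose h (z : R * R) := (g z.1 * g z.2)%:E.
have mh : measurable_fun [set: R * R] h.
  apply/measurable_EFinP; apply: measurable_funM.
    exact: (measurableT_comp mg measurable_fst).
  exact: (measurableT_comp mg measurable_snd).
have h1 z : (`|h z| <= 1)%E by rewrite lee_fin normrM mulr_ile1.
have mg' : measurable_fun [set: measurableTypeR R] (EFin \o g).
  exact/measurable_EFinP.
have iD (Q : probability R R) : Q.-integrable setT (EFin \o g).
  exact: (@integrable_bounded _ _ _ _ g 1).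
have ihZ : P.-integrable setT (h \o Zm).
  apply: (@integrable_bounded _ _ _ _ (fun w => g (Z1 w) * g (Z2 w)) 1) => [|w].
    by apply: measurable_funM; exact: measurableT_comp.
  by rewrite normrM mulr_ile1.
have ih : (D1 \x D2)%E.-integrable setT h.
  apply/integrableP; split => //.
  apply: (@le_lt_trans _ _ (\int[(D1 \x D2)%E]_z (cst 1%E z))%E).
    by apply: ge0_le_integral => //; exact: measurableT_comp.
  have := @product_measure1E _ _ _ _ _ D1 D2 setT setT measurableT measurableT.
  rewrite setXTT => DT; rewrite integral_cst// mul1e.
  have e1 : D1 [set: R] = 1%E := probability_setT D1.
  have e2 : D2 [set: R] = 1%E := probability_setT D2.
  have e12 : (D1 [set: R] * D2 [set: R] = 1)%E by rewrite e1 e2 mule1.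
  by rewrite -[X in (X < _)%E]/((D1 \x D2)%E [set: R * R]) DT e12 ltry.
have EZ (Z' : {RV P >-> R}) :
    (\int[distribution P Z']_x (g x)%:E = (\int[P]_w g (Z' w))%:E)%E.
  have iZ : P.-integrable setT ((EFin \o g) \o Z').
    apply: (@integrable_bounded _ _ _ _ (g \o Z') 1) => [|w]; last exact: g1.
    exact: measurableT_comp.
  rewrite (@integral_distribution _ _ _ _ _ P Z' _ mg' iZ) /Rintegral fineK//.
  exact: (integrable_fin_num _ iZ).
rewrite [LHS]/Rintegral -[RHS]/(fine _%:E); congr fine.
rewrite -[LHS](@integral_distribution _ _ _ _ _ P Zm h mh ihZ).
have joint A : measurable A -> A `<=` setT -> distribution P Zm A = (D1 \x D2)%E A.
  move=> mA _; apply/esym; move: A mA.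
  by apply: product_measure_unique => B1 B2 mB1 mB2; exact: indep.
rewrite (eq_measure_integral (D1 \x D2)%E joint).
rewrite -(integral12_prod_meas1 ih) /fubini_F /=.
under eq_integral => x _.
  under eq_integral => y _ do rewrite /h /= EFinM.
  rewrite integralZl//; last exact: iD.
  rewrite EZ.
  over.
by rewrite integralZr// ?EZ//; exact: iD.
Qed.

Lemma eq_law_Rintegral (Z1 Z2 : {RV P >-> R}) (g : R -> R) :
  measurable_fun [set: measurableTypeR R] g -> (forall y, `|g y| <= 1) ->
  (forall B : set R, measurable B -> P (Z1 @^-1` B) = P (Z2 @^-1` B)) ->
  \int[P]_w g (Z1 w) = \int[P]_w g (Z2 w).
Proof.
move=> mg g1 eqlaw; rewrite /Rintegral; congr fine.
have mg' : measurable_fun [set: measurableTypeR R] (EFin \o g).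
  exact/measurable_EFinP.
have iZ (Z : {RV P >-> R}) : P.-integrable setT ((EFin \o g) \o Z).
  apply: (@integrable_bounded _ _ _ _ (g \o Z) 1) => [|w]; last exact: g1.
  exact: measurableT_comp.
rewrite -(@integral_distribution _ _ _ _ _ P Z1 _ mg' (iZ Z1)).
rewrite -(@integral_distribution _ _ _ _ _ P Z2 _ mg' (iZ Z2)).
by apply: eq_measure_integral => B mB _; exact: eqlaw.
Qed.

End Independence.

Section Increments.
Context {R : realType} {d : measure_display} {T : measurableType d}.
Variable P : probability T R.
Variables (X : R -> {RV P >-> R}) (Delta : R).
Hypothesis levyX : is_levy_process X.
Hypothesis Delta0 : 0 < Delta.

Definition increment_RV (j : nat) : {RV P >-> R} :=
  X (j.+1%:R * Delta) - X (j%:R * Delta).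

(** Stationarity compares with X Delta - X 0, and X 0 vanishes almost surely. *)
Lemma law_increment (j : nat) (B : set R) : measurable B ->
  P (increment_RV j @^-1` B) = P (X Delta @^-1` B).
Proof.
move=> mB; have [X00 _ stat _ _] := levyX.
have jD : 0 <= j%:R * Delta by rewrite mulr_ge0// ltW.
have -> : P (increment_RV j @^-1` B) = P [set w | B (X Delta w - X 0 w)].
  rewrite -(stat (j%:R * Delta) Delta B jD (ltW Delta0) mB); congr (P _).
  by rewrite /increment_RV -[X in X * Delta]natr1 mulrDl mul1r.
have mX0 : measurable [set w | B (X Delta w - X 0 w)].
  rewrite -[X in measurable X]setTI.
  by apply: (measurable_funP (X Delta - X 0 : {RV P >-> R})).
have mX : measurable (X Delta @^-1` B).
  rewrite -[X in measurable X]setTI.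
  by apply: (measurable_funP (X Delta)).
have EP (C : set T) : measurable C -> P C = (\int[P]_w (\1_C w)%:E)%E.
  by move=> mC; rewrite integral_indic// setIT.
rewrite (EP _ mX0) (EP _ mX); apply: ge0_ae_eq_integral => //.
- exact/measurable_EFinP/measurable_indic.
- exact/measurable_EFinP/measurable_indic.
apply: filterS X00 => w X0w _; congr EFin; rewrite !indicE; congr (nat_of_bool _)%:R.
by apply/idP/idP; rewrite !inE /= X0w subr0.
Qed.

(** Mutual independence, applied to the two-element index set. *)
Lemma independent_increments (n : nat) (i j : 'I_n) (A B : set R) : i != j ->
  measurable A -> measurable B ->
  P (increment_RV i @^-1` A `&` increment_RV j @^-1` B) =
  (P (increment_RV i @^-1` A) * P (increment_RV j @^-1` B))%E.
Proof.
move=> ij mA mB; have [_ indep _ _ _] := levyX.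
pose t (k : nat) := k%:R * Delta.
have t0 : 0 <= t 0%N by rewrite /t mul0r.
have tS k : t k <= t k.+1 by rewrite /t ler_pM2r// ler_nat.
pose S (k : 'I_n) : set R := if k == i then A else B.
have mS k : measurable (S k) by rewrite /S; case: ifP.
have := indep n t t0 tS [set i; j]%SET S mS.
rewrite big_setU1 ?inE//= big_set1 /S eqxx eq_sym (negbTE ij) => <-.
congr (P _); apply/seteqP; split => w /=.
- move=> [Aw Bw] k /=; rewrite !inE => /orP[|] /eqP->; first by rewrite eqxx.
  by rewrite eq_sym (negbTE ij).
- move=> h; split.
    by have := h i; rewrite /= !inE eqxx /=; exact.
  by have := h j; rewrite /= !inE eqxx orbT eq_sym (negbTE ij) /=; exact.
Qed.

End Increments.

(** * The characteristic exponent *)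

Section CosineBounds.
Context {R : realType}.
Implicit Types y : R.

(** Cauchy's mean value theorem against y^2, then the mean value theorem for
    sin; it yields both bounds with explicit constants. *)
Let oneBcos_MVT y : 0 < y -> exists2 c, 0 < c < y & 1 - cos y = cos c / 2 * y ^+ 2.
Proof.
move=> y0.
have d1 (x : R) : x \in `]0, y[ -> is_derive x (1 : R) (fun x => - cos x) (sin x).
  by move=> _; have := is_deriveN (is_derive_cos x); rewrite opprK.
have d2 (x : R) : x \in `]0, y[ -> is_derive x (1 : R) (fun x => x ^+ 2) (2 * x).
  move=> _; have h := is_deriveX 2 (is_derive_id x (1 : R)).
  by apply: (is_derive_eq h); rewrite /GRing.scale /= mulr1 expr1.
have c1 : {within `[0, y], continuous (fun x : R => - cos x)}.
  apply: continuous_subspaceT => x; apply: cvgN; exact: continuous_cos.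
have c2 : {within `[0, y], continuous (fun x : R => x ^+ 2)}.
  by apply: continuous_subspaceT => x; exact: exprn_continuous.
have [x|c] := cauchy_MVT y0 c1 c2 d1 d2.
  by rewrite in_itv/= => /andP[x0 _]; rewrite mulf_neq0// gt_eqF.
rewrite in_itv/= => /andP[c0 cy] E.
have [c' + E'] := MVT c0 (fun x _ => is_derive_sin x)
  (continuous_subspaceT (@continuous_sin R)).
rewrite in_itv/= => /andP[c'0 c'c]; exists c'; first by rewrite c'0 (lt_trans c'c).
move: E' E; rewrite sin0 !subr0 cos0 expr0n subr0 opprK => -> E.
have y2 : y ^+ 2 != 0 by rewrite expf_neq0// gt_eqF.
move/(congr1 ( *%R^~ (y ^+ 2))): E; rewrite /= divfK// addrC => <-.
by field; rewrite gt_eqF.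
Qed.

Lemma oneBcos_le y : 1 - cos y <= y ^+ 2 / 2.
Proof.
wlog y0 : y / 0 < y.
  move=> h; have [y0|y0|<-] := ltgtP 0 y; first exact: h.
    by rewrite -cosN -sqrrN; apply: h; rewrite oppr_gt0.
  by rewrite cos0 subrr expr0n mul0r.
have [c _ ->] := oneBcos_MVT y0.
by rewrite mulrC ler_wpM2l ?sqr_ge0// ler_piMl// cos_le1.
Qed.

Lemma oneBcos_ge y : `|y| <= 1 -> cos 1 / 2 * y ^+ 2 <= 1 - cos y.
Proof.
wlog y0 : y / 0 < y.
  move=> h; have [y0|y0|<-] := ltgtP 0 y; first exact: h.
    by rewrite -[cos y]cosN -[y ^+ 2]sqrrN -normrN; apply: h; rewrite oppr_gt0.
  by rewrite cos0 subrr expr0n mulr0.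
rewrite gtr0_norm// => y1; have [c /andP[c0 cy] ->] := oneBcos_MVT y0.
rewrite ler_wpM2r ?sqr_ge0// ler_pM2r ?invr_gt0//.
have cpi : c <= pi by rewrite (le_trans (ltW cy))// (le_trans y1)// (le_trans _ (pi_ge2 R))// ler1n.
have pi1 : (1 : R) <= pi by rewrite (le_trans _ (pi_ge2 R))// ler1n.
rewrite ltW// ltr_cos ?in_itv/= ?(ltW c0) ?cpi ?ler01//.
exact: lt_le_trans y1.
Qed.

End CosineBounds.

Section Exponent.
Local Open Scope complex_scope.
Context {R : realType}.
Let mu := @lebesgue_measure R.

Lemma Re_levy_exponent (t : levy_triplet R) (u : R) :
  complex.Re (levy_exponent t u) =
  - (gauss_var t * u ^+ 2 / 2) - \int[levy_meas t]_x (1 - cos (u * x)).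
Proof.
rewrite /levy_exponent /= /cexp /= sub0r; congr (_ + _).
rewrite /Rintegral -fineN; congr fine; rewrite -integral_ge0N; last first.
  by move=> x _; rewrite lee_fin subr_ge0 cos_le1.
apply: eq_integral => x _; rewrite expR0 mul1r mul0r subr0 oppr0 addr0.
by rewrite -EFinN opprB.
Qed.

Lemma jump_exponent_ge0 (t : levy_triplet R) (u : R) :
  0 <= \int[levy_meas t]_x (1 - cos (u * x)).
Proof. by apply: Rintegral_ge0 => x _; rewrite subr_ge0 cos_le1. Qed.

(** Only jumps of size at most 1/u are used; there the oscillation 1 - cos(ux)
    is comparable to (ux)^2, so the truncated second moment bounds it below. *)
Lemma jump_exponent_ge (M alpha : R) (t : levy_triplet R) (u : R) :
  class_plus M alpha t -> 1 <= u ->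
  cos 1 / 2 * M * u `^ alpha <= \int[levy_meas t]_x (1 - cos (u * x)).
Proof.
move=> [_ [_ _ nufin] [p nup trunc]] u1; have u0 : 0 < u by exact: lt_le_trans u1.
have c0 : 0 <= cos 1 / 2 :> R by rewrite divr_ge0// ltW// cos1_gt0.
have mcos : measurable_fun [set: measurableTypeR R] (fun x => 1 - cos (u * x) : R).
  by apply: measurable_funB => //; under eq_fun do rewrite -[u * _]subr0;
    exact: measurable_cos_phase1.
have cos0' x : 0 <= 1 - cos (u * x) by rewrite subr_ge0 cos_le1.
have p0 x : 0 <= p x by case: nup.
have mp : measurable_fun [set: measurableTypeR R] p by case: nup.
have mx2 : measurable_fun [set: measurableTypeR R] (fun x => x ^+ 2 : R).
  exact: measurable_funX.
have fin : (\int[levy_meas t]_x (1 - cos (u * x))%:E < +oo)%E.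
  (* 1 - cos (u x) <= K min(x^2, 1), which nu integrates *)
  pose K := 2 + u ^+ 2.
  apply: (@le_lt_trans _ _ (\int[levy_meas t]_x (K%:E * (Num.min (x ^+ 2) 1)%:E))%E).
    apply: ge0_le_integral => //.
    - exact/measurable_EFinP.
    - by apply/measurable_EFinP/measurable_funM => //; exact: measurable_minr.
    - move=> x _; rewrite -EFinM lee_fin minEle; case: ifPn => x1.
        rewrite (le_trans (oneBcos_le _))// exprMn /K.
        have := sqr_ge0 u; have := sqr_ge0 x => hx hu; nra.
      rewrite mulr1 /K; have := sqr_ge0 u; have := cos_geN1 (u * x); lra.
  rewrite ge0_integralZl//.
  - by rewrite lte_mul_pinfty// lee_fin /K addr_ge0// sqr_ge0.
  - by apply/measurable_EFinP; exact: measurable_minr.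
  - by move=> x _; rewrite lee_fin le_min sqr_ge0 ler01.
  - by rewrite lee_fin /K addr_ge0// sqr_ge0.
rewrite -lee_fin /Rintegral fineK; last first.
  by rewrite ge0_fin_numE// integral_ge0.
rewrite (ge0_integral_density nup); [|exact/measurable_EFinP|by move=> x; rewrite lee_fin].
pose D : set R := `[(- u^-1)%R, u^-1]%classic.
have mD : measurable D by exact: measurable_itv.
apply: (@le_trans _ _ (\int[mu]_(x in D) ((1 - cos (u * x))%:E * (p x)%:E))%E); last first.
  apply: ge0_subset_integral => //.
  - by apply: emeasurable_funM; exact/measurable_EFinP.
  - by move=> x _; rewrite mule_ge0 ?lee_fin.
apply: (@le_trans _ _ (\int[mu]_(x in D)
    ((cos 1 / 2 * u ^+ 2)%:E * (x ^+ 2 * p x)%:E))%E); last first.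
  apply: ge0_le_integral => //.
  - move=> x _; rewrite -EFinM lee_fin; apply: mulr_ge0.
      by rewrite mulr_ge0// sqr_ge0.
    by rewrite mulr_ge0// sqr_ge0.
  - apply/measurable_EFinP/measurable_funTS/measurable_funM => //.
    exact: measurable_funM.
  - by apply: emeasurable_funM; apply/measurable_EFinP/measurable_funTS.
  - move=> x; rewrite /D /= in_itv/= => xu; rewrite -!EFinM lee_fin.
    rewrite [leLHS](_ : _ = cos 1 / 2 * (u * x) ^+ 2 * p x); last by ring.
    rewrite ler_wpM2r//; apply: oneBcos_ge.
    by rewrite normrM gtr0_norm// -ler_pdivlMl// mulr1 ler_norml.
rewrite ge0_integralZl//; last 3 first.
- by apply/measurable_EFinP/measurable_funTS/measurable_funM.
- by move=> x _; rewrite lee_fin mulr_ge0// sqr_ge0.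
- by rewrite lee_fin mulr_ge0// sqr_ge0.
apply: (@le_trans _ _ ((cos 1 / 2 * u ^+ 2)%:E * (M * u^-1 `^ (2 - alpha))%:E)%E).
  rewrite -EFinM lee_fin -[u^-1]powR_inv1 ?(ltW u0)// -powRrM mulN1r opprB.
  rewrite powRB ?(gt_eqF u0) ?implybT// powR_mulrn ?(ltW u0)// le_eqVlt.
  by apply/orP; left; apply/eqP; field; rewrite gt_eqF.
have cu0 : 0 <= cos 1 / 2 * u ^+ 2 by rewrite mulr_ge0// sqr_ge0.
rewrite lee_wpmul2l ?lee_fin//.
by apply: trunc; rewrite ?invr_gt0// invf_le1.
Qed.


(** Since (u/m)^beta >= 1 + beta ln(u/m), a stretched exponential decays at least
    like (m/u)^2 beyond the point m where it has dropped to exp(-L). *)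
Lemma stretched_exp_tail_le (K beta m L u : R) : 0 < m -> m <= u -> 0 <= L ->
  K * m `^ beta = L -> 2 <= beta * L ->
  expR (- (K * u `^ beta)) <= expR (- L) * (m / u) ^+ 2.
Proof.
move=> m0 mu0 L0 KL bL; have u0 : 0 < u by exact: lt_le_trans mu0.
have um : 0 < u / m by rewrite divr_gt0.
pose l := ln (u / m).
have l0 : 0 <= l by rewrite ln_ge0// ler_pdivlMr// mul1r.
have -> : K * u `^ beta = L * (u / m) `^ beta.
  rewrite -KL -mulrA -powRM ?(ltW m0) ?(ltW um)//; congr (_ * _ `^ _).
  by rewrite mulrCA divff ?mulr1// gt_eqF.
have -> : (m / u) ^+ 2 = expR (- (2 * l)).
  by rewrite expRN expRM_natl lnK ?posrE// -exprVn invf_div.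
rewrite -expRD ler_expR -opprD lerN2.
rewrite /powR gt_eqF// -/l.
apply: (@le_trans _ _ (L * (1 + beta * l))); last first.
  by rewrite ler_wpM2l// expR_ge1Dx.
by rewrite mulrDr mulr1 lerD2l mulrA ler_wpM2r// [L * _]mulrC.
Qed.

(** Dominating the tail by a Poisson kernel of width m makes its integral
    explicit. *)
Lemma sqr_ratio_le_poisson (m u : R) : 0 < m -> m <= u ->
  (m / u) ^+ 2 <= m * poisson m u.
Proof.
move=> m0 mu0; have u0 : 0 < u by exact: lt_le_trans mu0.
have mu2 : m ^+ 2 <= u ^+ 2 by rewrite lerXn2r// nnegrE ltW.
rewrite /poisson expr_div_n ler_pdivrMr ?exprn_gt0// mulrA mulrAC.
rewrite ler_pdivlMr ?addr_gt0 ?exprn_gt0//.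
have := sqr_ge0 m; nra.
Qed.

End Exponent.

(** * The mean integrated squared error *)

Section Law.
Local Open Scope complex_scope.
Context {R : realType} {d : measure_display} {T : measurableType d}.
Variable P : probability T R.
Variables (Y : {RV P >-> R}) (f : R -> R).
Hypothesis Yf : has_lebesgue_density (distribution P Y) f.
Let mu := @lebesgue_measure R.

Lemma integrable_density : mu.-integrable setT (EFin \o f).
Proof.
have [mf f0 fE] := Yf; apply/integrableP; split; first exact/measurable_EFinP.
under eq_integral => x _ do rewrite /= ger0_norm//.
rewrite -fE//; exact: le_lt_trans (probability_le1 (distribution P Y) measurableT) (ltry 1).
Qed.

Lemma cos_transform_law (s u : R) :
  \int[P]_w cos (u * Y w - s) = cos_transform s f u.
Proof.
pose g (y : R) : R := cos (u * y - s).
have mg : measurable_fun [set: measurableTypeR R] g by exact: measurable_cos_phase1.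
have mY : measurable_fun [set: T] (Y : T -> measurableTypeR R).
  exact: (measurable_funP Y).
(* Y with values in the measurable type that carries the Lebesgue measure *)
pose Y' : {mfun T >-> measurableTypeR R} :=
  HB.pack (Y : T -> measurableTypeR R) (isMeasurableFun.Build _ _ _ _ _ mY).
have Y'f : has_lebesgue_density (distribution P Y') f by exact: Yf.
have iY : P.-integrable setT ((EFin \o g) \o Y').
  apply: (@integrable_bounded _ _ _ _ (g \o Y) 1) => [|w]; last exact: cos_max.
  exact: measurableT_comp mg mY.
have mg' : measurable_fun [set: measurableTypeR R] (EFin \o g).
  exact/measurable_EFinP.
transitivity (\int[distribution P Y']_y g y).
  by rewrite /Rintegral (@integral_distribution _ _ _ _ _ P Y' _ mg' iY).
rewrite (Rintegral_density Y'f mg); apply: eq_Rintegral => y _.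
by rewrite /g [u * y]mulrC.
Qed.

Lemma char_funE u :
  char_fun P Y u = cos_transform 0 f u +i* cos_transform (pi / 2) f u.
Proof.
rewrite -!cos_transform_law /char_fun /cintegral; congr (_ +i* _).
  by apply: eq_Rintegral => w _; rewrite cexp_imag subr0.
by apply: eq_Rintegral => w _; rewrite cexp_imag cosBpihalf.
Qed.

Lemma sqr_char_funE u z : char_fun P Y u = cexp z ->
  cos_transform 0 f u ^+ 2 + cos_transform (pi / 2) f u ^+ 2 =
  expR (2 * complex.Re z).
Proof.
rewrite char_funE /cexp => -[-> ->]; rewrite !mul0r subr0 addr0.
rewrite !exprMn -mulrDr cos2Dsin2 mulr1.
by rewrite expRM_natl.
Qed.

End Law.

Section Risk.
Local Open Scope complex_scope.
Context {R : realType} {d : measure_display} {T : measurableType d}.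
Variable P : probability T R.
Variables (X : R -> {RV P >-> R}) (t : levy_triplet R) (f : R -> R).
Variables (Delta : R) (n : nat) (m : R).
Let mu := @lebesgue_measure R.
Hypothesis levyX : is_levy_process_with_triplet X t.
Hypothesis Delta0 : 0 < Delta.
Hypothesis Xf : has_lebesgue_density (distribution P (X Delta)) f.
Hypothesis var0 : 0 < gauss_var t.
Hypothesis n0 : (0 < n)%N.
Hypothesis m0 : 0 < m.

Let a s := cos_transform s f.

Let Z (w : T) : 'I_n -> R := increments Delta X w.

Let nR0 : (0 : R) < n%:R. Proof. by rewrite ltr0n. Qed.

Let mf : measurable_fun [set: measurableTypeR R] f. Proof. by case: Xf. Qed.

Let fi : mu.-integrable setT (EFin \o f). Proof. exact: integrable_density Xf. Qed.

Let ma s : measurable_fun [set: measurableTypeR R] (a s).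
Proof. exact: measurable_cos_transform. Qed.

Lemma sqr_char_fun_levy u : a 0 u ^+ 2 + a (pi / 2) u ^+ 2 =
  expR (2 * Delta * complex.Re (levy_exponent t u)).
Proof.
have [_ /(_ u Delta (ltW Delta0)) cfE] := levyX.
rewrite (sqr_char_funE Xf cfE) -mulrA; congr (expR (2 * _)).
by case: (levy_exponent t u) => x y /=; rewrite mul0r subr0.
Qed.

Lemma sqr_char_fun_gauss_le u : a 0 u ^+ 2 + a (pi / 2) u ^+ 2 <=
  expR (- (Delta * gauss_var t * u ^+ 2)).
Proof.
rewrite sqr_char_fun_levy ler_expR Re_levy_exponent.
have J0 := jump_exponent_ge0 t u.
rewrite [leLHS](_ : _ = - (Delta * gauss_var t * u ^+ 2) -
  2 * Delta * \int[levy_meas t]_x (1 - cos (u * x))); last by field.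
by rewrite gerDl oppr_le0 mulr_ge0// mulr_ge0// ltW.
Qed.

(** The Gaussian component makes the characteristic function integrable, since
    exp(-c u^2) <= 1 / (1 + c u^2), which is a multiple of a Poisson kernel. *)
Let integrable_a s : s = 0 \/ s = pi / 2 -> mu.-integrable setT (EFin \o a s).
Proof.
move=> sE; pose c := Delta * gauss_var t / 2.
have c0 : 0 < c by rewrite divr_gt0// mulr_gt0.
pose e := Num.sqrt c^-1.
have e0 : 0 < e by rewrite sqrtr_gt0 invr_gt0.
have ip : mu.-integrable setT (EFin \o (fun u => e / 2 * poisson e u)).
  apply: integrable_scale; apply/integrableP; split.
    apply/measurable_EFinP.
    exact: (continuous_measurable_fun (continuous_poisson e0)).
  have E : (\int[mu]_u (poisson e u)%:E = (2 * pi)%:E)%E.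
    by rewrite -(integral_poisson e0 0); apply: eq_integral => u _; rewrite subr0.
  under eq_integral => u _ do rewrite /= ger0_norm ?poisson_ge0//.
  by rewrite E ltry.
apply: (le_integrable _ _ _ ip) => //; first exact/measurable_EFinP.
move=> u _ /=; rewrite lee_fin [leRHS]ger0_norm; last first.
  by rewrite mulr_ge0 ?poisson_ge0// divr_ge0// ltW.
have a2 : a s u ^+ 2 <= a 0 u ^+ 2 + a (pi / 2) u ^+ 2.
  by case: sE => ->; rewrite ?lerDl ?lerDr sqr_ge0.
have sq : a s u ^+ 2 <= (expR (- (c * u ^+ 2))) ^+ 2.
  rewrite (le_trans a2)// (le_trans (sqr_char_fun_gauss_le u))//.
  by rewrite -expRM_natl ler_expR /c le_eqVlt; apply/orP; left; apply/eqP; field.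
have : `|a s u| <= expR (- (c * u ^+ 2)).
  by rewrite -ler_sqr ?nnegrE ?expR_ge0// real_normK ?num_real.
move=> /le_trans; apply.
have e2 : e ^+ 2 = c^-1 by rewrite sqr_sqrtr// invr_ge0 ltW.
have -> : e / 2 * poisson e u = (1 + c * u ^+ 2)^-1.
  rewrite (_ : e / 2 * poisson e u = e ^+ 2 / (e ^+ 2 + u ^+ 2)); last first.
    by rewrite /poisson; field; rewrite gt_eqF// ltr_pwDl ?sqr_ge0// exprn_gt0.
  rewrite e2; field.
  by rewrite !gt_eqF//= ltr_pwDl ?sqr_ge0// mulr_ge0 ?sqr_ge0// ltW.
rewrite expRN lef_pV2 ?posrE ?expR_gt0// ?expR_ge1Dx//.
by rewrite ltr_pwDl// mulr_ge0 ?sqr_ge0// ltW.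
Qed.

(** The squared characteristic function beyond the cutoff, in the form in which
    its integral is of order m/n. *)
Hypothesis tail : forall u, m < `|u| ->
  expR (2 * Delta * complex.Re (levy_exponent t u)) <= n%:R^-1 * (m * poisson m u).

Let error s w u := (cut_emp_cos m (Z w) s u - a s u) ^+ 2.

(** On [-m, m] this is the variance of the empirical characteristic function,
    outside it is the squared characteristic function itself. *)
Let expected_error_le s u : s = 0 \/ s = pi / 2 ->
  (\int[P]_w (error s w u)%:E <=
   (n%:R^-1 * (\1_`[- m, m] u + m * poisson m u))%:E)%E.
Proof.
move=> sE.
have P0 : 0 <= m * poisson m u by rewrite mulr_ge0 ?poisson_ge0// ltW.
have n10 : 0 <= n%:R^-1 :> R by rewrite invr_ge0.
have [um|um] := boolP (u \in `[- m, m]%classic).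
- rewrite /error /cut_emp_cos /emp_cos indicE um.
  pose g (y : R) : R := cos (u * y - s).
  have mg : measurable_fun [set: measurableTypeR R] g.
    exact: measurable_cos_phase1.
  have g1 y : `|g y| <= 1 by exact: cos_max.
  have levy := levyX.1.
  have EY j : \int[P]_w g (increment_RV X Delta j w) = a s u.
    rewrite /a -(cos_transform_law Xf); apply: (eq_law_Rintegral mg g1).
    exact: law_increment.
  apply: le_trans (_ : (n%:R^-1%:E <= _)%E); last first.
    by rewrite lee_fin ler_peMr// lerDl.
  apply: le_trans (variance_mean_le (c := a s u)
    (Y := fun (i : 'I_n) w => g (increment_RV X Delta i w)) n0 _ _ _ _) => //.
  + by apply: ge0_le_integral_nonmeasurable => w; rewrite lee_fin ?sqr_ge0// mul1r.
  + by move=> i; exact: measurableT_comp.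
  + move=> i j ij; rewrite (independent_RintegralM mg g1) ?EY//.
    by move=> A B mA mB; exact: independent_increments.
- have -> : (\int[P]_w (error s w u)%:E = (a s u ^+ 2)%:E)%E.
    transitivity (\int[P]_w (a s u ^+ 2)%:E)%E.
      apply: eq_integral => w _; rewrite /error /cut_emp_cos indicE (negbTE um).
      by rewrite mul0r sub0r sqrrN.
    rewrite integral_cst//; have /= -> := @probability_setT _ _ _ P.
    by rewrite mule1.
  rewrite lee_fin indicE (negbTE um) add0r.
  have um' : m < `|u|.
    rewrite ltNge; apply: contra um => um; rewrite mem_setE in_itv/=.
    by rewrite -ler_norml.
  have := tail um'; rewrite -sqr_char_fun_levy; apply: le_trans.
  by case: sE => ->; rewrite ?lerDl ?lerDr sqr_ge0.
Qed.

Let mZ (j : 'I_n) : measurable_fun [set: T] (Z ^~ j).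
Proof. exact: (measurable_funP (increment_RV X Delta j)). Qed.

Let merror s : measurable_fun [set: T * measurableTypeR R]
  (fun z => error s z.1 z.2).
Proof.
apply: measurable_funX; apply: measurable_funB; last first.
  exact: (measurableT_comp (ma s) measurable_snd).
apply: measurable_funM.
  have mind : measurable_fun [set: measurableTypeR R] (\1_(`[- m, m]%classic) : R -> R).
    exact: measurable_indic.
  exact: (measurableT_comp mind measurable_snd).
apply: measurable_funM => //; apply: measurable_sum => j.
apply: (measurableT_comp (continuous_measurable_fun (@continuous_cos R))) => /=.
apply: measurable_funB => //; apply: measurable_funM.
  exact: measurable_snd.
exact: (measurableT_comp (mZ j) measurable_fst).
Qed.

Let integral_expected_error_le s : s = 0 \/ s = pi / 2 ->
  (\int[P]_w \int[mu]_u (error s w u)%:E <= (n%:R^-1 * ((2 + 2 * pi) * m))%:E)%E.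
Proof.
move=> sE.
have n10 : 0 <= n%:R^-1 :> R by rewrite invr_ge0.
have P0 u : 0 <= m * poisson m u by rewrite mulr_ge0 ?poisson_ge0// ltW.
have mind : measurable_fun [set: measurableTypeR R] (\1_(`[- m, m]%classic) : R -> R).
  exact: measurable_indic.
have mP : measurable_fun [set: measurableTypeR R] (fun u => m * poisson m u).
  by apply: measurable_funM => //; exact: (continuous_measurable_fun (continuous_poisson m0)).
have mPe : measurable_fun [set: measurableTypeR R]
    (fun u => m%:E * (poisson m u)%:E)%E.
  by have := (measurable_EFinP _ _).2 mP.
have minde : measurable_fun [set: measurableTypeR R]
    (fun u => (\1_(`[- m, m]%classic : set R) u)%:E : \bar R).
  exact/measurable_EFinP.
rewrite (@ge0_integral_exchange _ _ _ _ _ P mu (fun w u => error s w u))//; last first.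
  by move=> w u; exact: sqr_ge0.
apply: (@le_trans _ _ (\int[mu]_u
    (n%:R^-1%:E * ((\1_`[- m, m] u)%:E + (m%:E * (poisson m u)%:E))))%E).
  apply: ge0_le_integral => //.
  - by move=> u _; apply: integral_ge0 => w _; rewrite lee_fin sqr_ge0.
  - apply: (@ge0_measurable_integral_param _ _ _ _ _ P (fun u w => error s w u)).
      exact: (measurable_fun_swap (k := fun w u => error s w u) (merror s)).
    by move=> u w; exact: sqr_ge0.
  - by apply/measurable_EFinP/measurable_funM => //; exact: measurable_funD.
  - by move=> u _; exact: expected_error_le.
rewrite ge0_integralZl//; last 2 first.
- exact: emeasurable_funD.
- by move=> u _; rewrite adde_ge0// -?EFinM lee_fin.
rewrite EFinM lee_wpmul2l ?lee_fin// ge0_integralD//; last first.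
- by move=> u _; rewrite -EFinM lee_fin.
rewrite ge0_integralZl//; last 3 first.
- apply/measurable_EFinP.
  exact: (continuous_measurable_fun (continuous_poisson m0)).
- by move=> u _; rewrite lee_fin poisson_ge0.
- by rewrite lee_fin ltW.
have -> : (\int[mu]_u (poisson m u)%:E = (2 * pi)%:E)%E.
  by rewrite -(integral_poisson m0 0); apply: eq_integral => u _; rewrite subr0.
rewrite integral_indic// setIT. rewrite /= lebesgue_measure_itv/= lte_fin.
rewrite ifT ?gtrN// -EFinB -EFinM -EFinD lee_fin; lra.
Qed.

(** The bias-variance bound: the empirical characteristic function has variance
    at most 1/n on [-m, m], and the tail hypothesis makes the bias of the same
    order m/n. *)
Lemma MISE_le : (MISE n Delta X m f <= (6 * (m / n%:R))%:E)%E.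
Proof.
have s0 : (0 : R) = 0 \/ (0 : R) = pi / 2 by left.
have s1 : (pi / 2 : R) = 0 \/ (pi / 2 : R) = pi / 2 by right.
have p10 : 0 <= pi^-1 :> R by rewrite invr_ge0 pi_ge0.
pose I s w := (\int[mu]_u (error s w u)%:E)%E.
have I0 s w : (0 <= I s w)%E.
  by apply: integral_ge0 => u _; rewrite lee_fin sqr_ge0.
have mI s : measurable_fun [set: T] (I s).
  apply: (@ge0_measurable_integral_param _ _ _ _ _ mu (fun w u => error s w u)).
    exact: merror.
  by move=> w u; exact: sqr_ge0.
pose ha : R := pi / 2.
apply: (@le_trans _ _ (\int[P]_w (pi^-1%:E * (I 0%R w + I ha w)%E))%E).
  apply: ge0_le_integral_nonmeasurable => w.
    by rewrite expe2 mule_ge0// Lnorm_ge0.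
  by apply: (integrated_squared_error_le m (Z w) fi); exact: integrable_a.
rewrite ge0_integralZl//; last 2 first.
- exact: emeasurable_funD.
- by move=> w _; rewrite adde_ge0.
rewrite ge0_integralD//.
apply: (@le_trans _ _ (pi^-1%:E * ((n%:R^-1 * ((2 + 2 * pi) * m))%:E +
    (n%:R^-1 * ((2 + 2 * pi) * m))%:E))%E).
  by rewrite lee_wpmul2l ?lee_fin// leeD// integral_expected_error_le.
have p0 : (pi : R) != 0 by rewrite gt_eqF// pi_gt0.
rewrite -EFinD -EFinM lee_fin.
(* 4 / pi + 4 <= 6 since pi >= 2 *)
rewrite [leLHS](_ : _ = (4 * pi^-1 + 4) * (m / n%:R)); last first.
  by move: (pi : R) p0 => p p0; field; rewrite p0 gt_eqF.
rewrite ler_wpM2r ?divr_ge0 ?(ltW m0)//.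
have : pi^-1 <= 2^-1 :> R by rewrite lef_pV2 ?posrE ?pi_gt0// pi_ge2.
by move: (pi^-1 : R) => q; lra.
Qed.

End Risk.

(** * Rates *)

Section Rates.
Local Open Scope complex_scope.
Context {R : realType}.

Lemma near_le_ln (A : R) : \forall n \near \oo, A <= ln n%:R :> R.
Proof.
near=> n.
have An : expR A <= n%:R by near: n; exact: nbhs_infty_ger.
by rewrite -[A]expRK ler_ln ?posrE ?expR_gt0// (lt_le_trans (expR_gt0 A)).
Unshelve. all: by end_near. Qed.

Lemma eqO_scale (g h : nat -> R) (k : R) :
  (\forall n \near \oo, g n = k * h n) -> g =O_\oo h.
Proof.
move=> gh; apply/eqO_exP; exists (`|k| + 1); first by rewrite ltr_wpDl.
near=> n; rewrite (_ : g n = k * h n); last by near: n.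
by rewrite normrM ler_wpM2r// lerDl.
Unshelve. all: by end_near. Qed.

(** Both regimes at once: |phi(u)|^2 <= exp(-K |u|^beta) with a cutoff at which
    this bound equals 1/n. *)
Lemma MISE_le_of_decay {d : measure_display} {T : measurableType d}
    (P : probability T R) (X : R -> {RV P >-> R}) (t : levy_triplet R)
    (f : R -> R) (Delta m K beta : R) (n : nat) :
  is_levy_process_with_triplet X t -> 0 < Delta ->
  has_lebesgue_density (distribution P (X Delta)) f -> 0 < gauss_var t ->
  (0 < n)%N -> 0 < m -> 0 <= ln n%:R :> R -> K * m `^ beta = ln n%:R ->
  2 <= beta * ln n%:R ->
  (forall u, m < `|u| ->
    2 * Delta * complex.Re (levy_exponent t u) <= - (K * `|u| `^ beta)) ->
  (MISE n Delta X m f <= (6 * (m / n%:R))%:E)%E.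
Proof.
move=> levyX D0 Xf v0 n0 m0 L0 KL bL decay.
apply: (MISE_le levyX D0 Xf v0 n0 m0) => u mu0.
have nR0 : (0 : R) < n%:R by rewrite ltr0n.
apply: (@le_trans _ _ (expR (- (K * `|u| `^ beta)))).
  by rewrite ler_expR decay.
apply: (le_trans (stretched_exp_tail_le m0 (ltW mu0) L0 KL bL)).
rewrite expRN lnK ?posrE// ler_wpM2l ?invr_ge0//.
rewrite (le_trans (sqr_ratio_le_poisson m0 (ltW mu0)))//.
by rewrite /poisson real_normK ?num_real.
Qed.

Lemma Re_levy_exponent_norm (t : levy_triplet R) (u : R) :
  complex.Re (levy_exponent t u) = complex.Re (levy_exponent t `|u|).
Proof.
rewrite !Re_levy_exponent real_normK ?num_real//; congr (_ - _).
apply: eq_Rintegral => x _; congr (_ - _).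
have [u0|u0] := ger0P u; first by [].
by rewrite mulNr cosN.
Qed.

End Rates.

Theorem theorem5 (R : realType) (M alpha : R) (hM : 0 < M)
    (halpha0 : 0 < alpha) (halpha2 : alpha < 2) :
  exists C Ctilde : R, [/\ 0 < C, 0 < Ctilde &
  forall (Delta : R) (sigma : nat -> R),
    0 < Delta ->
    (forall n, (0 < n)%N -> 0 < sigma n) ->
    sigma n @[n --> \oo] --> 0 ->
    (sigma n * ln n%:R `^ (alpha^-1 - 2^-1) @[n --> \oo] --> +oo ->
     exists m : nat -> R,
       [/\ forall n, 0 < m n,
           m =O_\oo (fun n => Num.sqrt (ln n%:R / (Delta * sigma n ^+ 2))) &
           forall (b : R) (nu : {measure set (measurableTypeR R) -> \bar R})
             (d : nat -> measure_display)
             (T : forall n, measurableType (d n))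
             (P : forall n, probability (T n) R)
             (X : forall n, R -> {RV P n >-> R})
             (f : nat -> R -> R),
             (forall n, (0 < n)%N ->
               [/\ class_plus M alpha (LevyTriplet b (sigma n ^+ 2) nu),
                   is_levy_process_with_triplet (X n)
                     (LevyTriplet b (sigma n ^+ 2) nu) &
                   has_lebesgue_density (distribution (P n) (X n Delta))
                     (f n)]) ->
             \forall n \near \oo,
               (MISE n Delta (X n) (m n) (f n) <=
                (C * (Num.sqrt (ln n%:R) /
                      (sigma n * n%:R * Delta `^ 2^-1)))%:E)%E]) /\
    ((fun n => sigma n * ln n%:R `^ (alpha^-1 - 2^-1)) =O_\oo (fun=> 1 : R) ->
     exists m : nat -> R,
       [/\ forall n, 0 < m n,
           m =O_\oo (fun n => ln n%:R `^ alpha^-1 * Delta `^ (- alpha^-1)) &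
           forall (b : R) (nu : {measure set (measurableTypeR R) -> \bar R})
             (d : nat -> measure_display)
             (T : forall n, measurableType (d n))
             (P : forall n, probability (T n) R)
             (X : forall n, R -> {RV P n >-> R})
             (f : nat -> R -> R),
             (forall n, (0 < n)%N ->
               [/\ class_plus M alpha (LevyTriplet b (sigma n ^+ 2) nu),
                   is_levy_process_with_triplet (X n)
                     (LevyTriplet b (sigma n ^+ 2) nu) &
                   has_lebesgue_density (distribution (P n) (X n Delta))
                     (f n)]) ->
             \forall n \near \oo,
               (MISE n Delta (X n) (m n) (f n) <=
                (Ctilde * (ln n%:R `^ alpha^-1 /
                           (n%:R * Delta `^ alpha^-1)))%:E)%E])].
Proof.
have c1 : 0 < cos 1 :> R by exact: cos1_gt0.
(* kappa = 2 M (cos 1 / 2), twice the constant of the jump exponent *)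
pose kappa := M * cos 1; have kappa0 : 0 < kappa by rewrite mulr_gt0.
exists 6, (6 * kappa `^ (- alpha^-1)); split => //.
  by rewrite mulr_gt0// powR_gt0.
move=> Delta sigma D0 sigma0 _.
have lnn0 n : (1 < n)%N -> 0 < ln n%:R :> R by move=> n1; rewrite ln_gt0// ltr1n.
split=> _.
(* m solves Delta sigma^2 m^2 = ln n; the value 1 replaces it where ln n <= 0 *)
- pose m n := if (1 < n)%N then Num.sqrt (ln n%:R / (Delta * sigma n ^+ 2)) else 1.
  have m0 n : 0 < m n.
    rewrite /m; case: ifPn => // n1; rewrite sqrtr_gt0 divr_gt0 ?lnn0//.
    by rewrite mulr_gt0// exprn_gt0// sigma0// ltnW.
  exists m; split => //.
    apply: (@eqO_scale _ _ _ 1); near=> n; rewrite mul1r /m ifT//.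
    by near: n; exact: nbhs_infty_gt.
  move=> b nu d T P X f H; near=> n.
  have n1 : (1 < n)%N by near: n; exact: nbhs_infty_gt.
  have n0 : (0 < n)%N by exact: ltnW.
  have ln1 : 1 <= ln n%:R :> R by near: n; exact: near_le_ln.
  have [[v0 _ _] levyX Xf] := H n n0.
  have s0 := sigma0 n n0.
  have nR0 : (0 : R) < n%:R by rewrite ltr0n.
  have Ds : Delta * sigma n ^+ 2 != 0 by rewrite mulf_neq0 ?expf_neq0 ?gt_eqF.
  have m2 : m n ^+ 2 = ln n%:R / (Delta * sigma n ^+ 2).
    rewrite /m n1 sqr_sqrtr// divr_ge0// ?(ltW (lnn0 n n1))//.
    by rewrite mulr_ge0 ?sqr_ge0// ltW.
  apply: le_trans (MISE_le_of_decay (K := Delta * sigma n ^+ 2) (beta := 2)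
    levyX D0 Xf v0 n0 (m0 n) _ _ _ _) _.
  + exact/ltW/lnn0.
  + by rewrite powR_mulrn ?(ltW (m0 n))// m2 mulrC divfK.
  + by lra.
  + move=> u _; rewrite powR_mulrn// real_normK ?num_real// Re_levy_exponent /=.
    have J0 := jump_exponent_ge0 (LevyTriplet b (sigma n ^+ 2) nu) u.
    rewrite mulrBr lerBlDr (@le_trans _ _ (- (Delta * sigma n ^+ 2 * u ^+ 2)))//.
      by rewrite le_eqVlt; apply/orP; left; apply/eqP; field.
    by rewrite lerDl mulr_ge0// mulr_ge0// ltW.
  rewrite lee_fin ler_wpM2l// /m n1 sqrtrM ?(ltW (lnn0 n n1))// sqrtrV; last first.
    by rewrite mulr_ge0 ?sqr_ge0// ltW.
  rewrite sqrtrM ?(ltW D0)// sqrtr_sqr gtr0_norm// powR12_sqrt ?(ltW D0)//.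
  rewrite le_eqVlt; apply/orP; left; apply/eqP; field.
  by rewrite !gt_eqF ?sqrtr_gt0.
(* m solves kappa Delta m^alpha = ln n, and exceeds 1 as soon as ln n >= kappa
   Delta, where the bound on the jump exponent starts *)
- pose m n := if (1 < n)%N then (ln n%:R / (kappa * Delta)) `^ alpha^-1 else 1.
  have kD : 0 < kappa * Delta by rewrite mulr_gt0.
  have m0 n : 0 < m n.
    by rewrite /m; case: ifPn => // n1; rewrite powR_gt0// divr_gt0// lnn0.
  have mE n : (1 < n)%N -> m n = kappa `^ (- alpha^-1) *
      (ln n%:R `^ alpha^-1 * Delta `^ (- alpha^-1)).
    move=> n1; rewrite /m n1 powRM ?invr_ge0 ?(ltW kD) ?(ltW (lnn0 n n1))//.
    rewrite -[(kappa * _)^-1]powR_inv1 ?(ltW kD)// -powRrM mulN1r.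
    by rewrite powRM ?(ltW kappa0) ?(ltW D0)//; ring.
  exists m; split => //.
    apply: (@eqO_scale _ _ _ (kappa `^ (- alpha^-1))); near=> n; apply: mE.
    by near: n; exact: nbhs_infty_gt.
  move=> b nu d T P X f H; near=> n.
  have n1 : (1 < n)%N by near: n; exact: nbhs_infty_gt.
  have n0 : (0 < n)%N by exact: ltnW.
  have lnk : kappa * Delta <= ln n%:R :> R by near: n; exact: near_le_ln.
  have lna : 2 / alpha <= ln n%:R :> R by near: n; exact: near_le_ln.
  have [cp levyX Xf] := H n n0.
  have v0 : 0 < gauss_var (LevyTriplet b (sigma n ^+ 2) nu) by case: cp.
  have nR0 : (0 : R) < n%:R by rewrite ltr0n.
  have ma : m n `^ alpha = ln n%:R / (kappa * Delta).
    rewrite /m n1 -powRrM mulVf ?gt_eqF// powRr1//.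
    by rewrite divr_ge0 ?(ltW kD)// ltW// lnn0.
  have m1 : 1 <= m n.
    rewrite leNgt; apply/negP => m1.
    have := gt0_ltr_powR halpha0 (ltW (m0 n) : m n \in Num.nneg) (ler01 : 1 \in Num.nneg) m1.
    rewrite ma powR1 ltr_pdivrMr// mul1r.
    by rewrite ltNge lnk.
  apply: le_trans (MISE_le_of_decay (K := kappa * Delta) (beta := alpha)
    levyX D0 Xf v0 n0 (m0 n) _ _ _ _) _.
  + exact/ltW/lnn0.
  + by rewrite ma mulrC divfK// gt_eqF.
  + by rewrite -ler_pdivrMl// mulrC.
  + move=> u mu0; rewrite Re_levy_exponent_norm Re_levy_exponent.
    have u1 : 1 <= `|u| by rewrite (le_trans m1)// ltW.
    have J := jump_exponent_ge cp u1.
    rewrite mulrBr lerBlDr (@le_trans _ _ 0)//.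
      rewrite mulrN oppr_le0; apply: mulr_ge0; first by rewrite mulr_ge0// ltW.
      by rewrite divr_ge0// mulr_ge0 ?sqr_ge0.
    rewrite addrC subr_ge0 (le_trans _ (ler_wpM2l _ J)) ?mulr_ge0 ?(ltW D0)//.
    by rewrite le_eqVlt; apply/orP; left; apply/eqP; rewrite /kappa; field.
  rewrite lee_fin mE// !powRN le_eqVlt.
  apply/orP; left; apply/eqP; field.
  by rewrite !gt_eqF ?powR_gt0.
Unshelve. all: by end_near. Qed.
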